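(* Let $d \geq 2$ and let $\alpha = (\alpha_1,\dots,\alpha_d) \in \mathbb{R}^d$ be badly approximable with constant $c_\alpha > 0$, i.e. for all positive integers $q$, $$ \max_{1 \leq j \leq d} \| \alpha_j q\| \geq \frac{c_{\alpha}}{q^{1/d}}.$$ Let $x_n = (n\alpha_1, n\alpha_2, \dots, n\alpha_d) \bmod 1 \in \mathbb{T}^d$ for $n \geq 1$ (the Kronecker sequence). Then there exists a constant $C > 0$ depending only on $c_\alpha$ and $d$ such that for all integers $N \geq 1$ $$ W_2\left(\frac{1}{N} \sum_{k=1}^{N}\delta_{x_k}, dx\right) \leq C\, N^{-1/d}.$$
   Context: For a real number $s$, $\|s\|$ denotes the distance from $s$ to the nearest integer. $\mathbb{T}^d = \mathbb{R}^d/\mathbb{Z}^d$, mod $1$ is taken componentwise, $\delta_x$ is the Dirac measure at $x$, and $dx$ is the normalized Lebesgue (Haar) probability measure on $\mathbb{T}^d$. For probability measures $\mu,\nu$ on $\mathbb{T}^d$, the $2$-Wasserstein distance is $$ W_2(\mu,\nu) = \left( \inf_{\gamma \in \Gamma(\mu,\nu)} \int_{\mathbb{T}^d\times\mathbb{T}^d} |x-y|^2 \, d\gamma(x,y) \right)^{1/2},$$ where $|x-y|$ is the usual distance on the torus and $\Gamma(\mu,\nu)$ is the set of all measures on $\mathbb{T}^d\times\mathbb{T}^d$ with marginals $\mu$ and $\nu$. *)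

(* Defs.v *)
From HB Require Import structures.
From mathcomp Require Import all_boot all_order all_algebra.
From mathcomp Require Import interval_inference.
From mathcomp Require Import all_classical all_reals all_analysis.

Set Implicit Arguments.
Unset Strict Implicit.
Unset Printing Implicit Defensive.

Import Order.TTheory GRing.Theory Num.Theory.
Import numFieldNormedType.Exports.

Local Open Scope classical_set_scope.
Local Open Scope ring_scope.

Section distance_to_integers.
Context {R : realType}.

Definition dist_int (s : R) : R := inf [set `|s - m%:~R| | m in [set: int]].

(* The default value 0 of the maximum is harmless: dist_int is nonnegative. *)
Definition badly_approximable d (alpha : 'rV[R]_d) (c : R) : Prop :=
  forall q : nat, (0 < q)%N ->
    c / q%:R `^ (d%:R^-1) <=
    \big[Num.max/0]_(j < d) dist_int (alpha ord0 j * q%:R).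

End distance_to_integers.

Section torus.
Context (R : realType) (d : nat).

Definition int_lattice : {pred 'rV[R]_d} :=
  fun x => [forall j, x ord0 j \is a Num.int].

Fact int_lattice_zmod_closed : zmod_closed int_lattice.
Proof.
split=> [|x y /forallP xZ /forallP yZ]; apply/forallP => j; rewrite !mxE.
  exact: rpred0.
by apply: rpredB.
Qed.

HB.instance Definition _ :=
  GRing.isZmodClosed.Build _ int_lattice int_lattice_zmod_closed.

Definition torus : Type := quotient_topology (Quotient.quot int_lattice).

HB.instance Definition _ := Quotient.on torus.
HB.instance Definition _ := PointedTopological.on torus.

(* The Borel sigma-algebra of the quotient topology. *)
HB.instance Definition _ := @isMeasurable.Build (sigma_display (@open torus))
  torus <<s @open torus >> (@sigma_algebra0 _ setT _)
  (@sigma_algebraC _ _) (@sigma_algebra_bigcup _ setT _).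

Definition mod1 (x : 'rV[R]_d) : torus := \pi_torus%qT x.

Definition euclidean_norm (u : 'rV[R]_d) : R :=
  Num.sqrt (\sum_(j < d) u ord0 j ^+ 2).

(* The quotient metric: the least Euclidean distance between representatives. *)
Definition torus_dist (x y : torus) : R :=
  inf [set euclidean_norm (u - v) | u in mod1 @^-1` [set x]
                                  & v in mod1 @^-1` [set y]].

End torus.

Section haar.
Context {R : realType}.

Definition tuple_cons d (p : measurableTypeR R * d.-tuple R) : d.+1.-tuple R :=
  [the d.+1.-tuple R of p.1 :: p.2].

Fact measurable_tuple_cons d :
  measurable_fun [set: measurableTypeR R * d.-tuple R] (@tuple_cons d).
Proof. exact: measurable_cons measurable_fst measurable_snd. Qed.

HB.instance Definition _ d := isMeasurableFun.Build _ _ _ _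
  (@tuple_cons d) (@measurable_tuple_cons d).

(* Lebesgue measure on [0, 1]^d, as the d-fold product of the uniform
   probability on [0, 1]. *)
Fixpoint cube_lebesgue d : probability (d.-tuple R) R :=
  if d is d'.+1 then
    distribution (uniform_prob (@ltr01 R) \x cube_lebesgue d')%E
                 (@tuple_cons d')
  else dirac [tuple].

Definition tuple_mod1 d (t : d.-tuple R) : torus R d :=
  mod1 (\row_j tnth t j).

Fact measurable_tuple_mod1 d :
  measurable_fun [set: d.-tuple R] (@tuple_mod1 d).
Proof.
apply: (measurability (@open (torus R d))) => // _ [V oV <-].
rewrite setTI.
pose box (q : {ffun 'I_d -> rat * rat}) := [set t : d.-tuple R |
  forall j, tnth t j \in `](ratr (q j).1), (ratr (q j).2)[].
pose F q := if `[< box q `<=` @tuple_mod1 d @^-1` V >] then box q else set0.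
have -> : @tuple_mod1 d @^-1` V = \bigcup_q F q.
  apply/seteqP; split=> [t Vt|t [q _]]; last first.
    by rewrite /F; case: asboolP => // + qt; exact.
  have oU : open ((@mod1 R d) @^-1` V) by exact: oV.
  have : nbhs (\row_j tnth t j) ((@mod1 R d) @^-1` V).
    by rewrite nbhsE; exists ((@mod1 R d) @^-1` V).
  rewrite -nbhs_ballE => -[e /= e0 tV].
  have /choice[q1 q1P] : forall j, exists q : rat,
      ratr q \in `](tnth t j - e), (tnth t j)[.
    by move=> j; apply: rat_in_itvoo; rewrite ltrBlDr ltrDl.
  have /choice[q2 q2P] : forall j, exists q : rat,
      ratr q \in `](tnth t j), (tnth t j + e)[.
    by move=> j; apply: rat_in_itvoo; rewrite ltrDl.
  pose q := [ffun j => (q1 j, q2 j)].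
  have qt : box q t.
    move=> j; rewrite ffunE/= in_itv/=.
    by move: (q1P j) (q2P j); rewrite !in_itv/= => /andP[_ ->] /andP[-> _].
  exists q => //; rewrite /F; case: asboolP => // -[] u qu.
  apply: tV; split=> // i j; rewrite !mxE /ball/= ltr_distlC.
  move: (qu j) (q1P j) (q2P j).
  rewrite ffunE/= !in_itv/= => /andP[h1 h2] /andP[h3 _] /andP[_ h4].
  by rewrite (lt_trans h3 h1) (lt_trans h2 h4).
apply: countable_bigcupT_measurable => // q; rewrite /F.
case: ifP => _ //.
rewrite (_ : box q = \bigcap_(j in [set: 'I_d])
    ((@tnth d R)^~ j @^-1` `](ratr (q j).1), (ratr (q j).2)[)); last first.
  by apply/seteqP; split=> t /= h j; [move=> _; exact: h|exact: h].
apply: fin_bigcap_measurable => // j _.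
by rewrite -[X in measurable X]setTI; exact: measurable_tnth.
Qed.

HB.instance Definition _ d := isMeasurableFun.Build _ _ _ _
  (@tuple_mod1 d) (@measurable_tuple_mod1 d).

Definition torus_haar d : probability (torus R d) R :=
  distribution (cube_lebesgue d) (@tuple_mod1 d).

End haar.
Arguments torus_haar R d : clear implicits.

Section wasserstein.
Context {R : realType} {d : nat}.
Local Notation T := (torus R d).
Local Open Scope ereal_scope.

Definition couplings (mu nu : {measure set T -> \bar R}) :
    set {measure set (T * T) -> \bar R} :=
  [set gamma | forall A : set T, measurable A ->
     pushforward gamma fst A = mu A /\ pushforward gamma snd A = nu A].

Definition W2 (mu nu : {measure set T -> \bar R}) : \bar R :=
  sqrte (ereal_inf [set \int[gamma]_p ((torus_dist p.1 p.2) ^+ 2)%:E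
                   | gamma in couplings mu nu]).

End wasserstein.

Section kronecker.
Context {R : realType} {d : nat}.

Definition kronecker (alpha : 'rV[R]_d) (n : nat) : torus R d :=
  mod1 (n%:R *: alpha).

(* The uniform measure on the points x 1, ..., x N. *)
Definition empirical_measure (x : nat -> torus R d) (N : nat) :
    {measure set (torus R d) -> \bar R} :=
  mscale (N%:R^-1)%:nng (msum (fun k => dirac (x k.+1)) N).

End kronecker.

(* Main.v *)
Require Import Defs.
From HB Require Import structures.
From mathcomp Require Import all_boot all_order all_algebra.
From mathcomp Require Import interval_inference ring lra zify.
From mathcomp Require Import all_classical all_reals all_analysis.
From mathcomp Require Import measurable_realfun.

(** The transport constructed below moves no mass further than a constant times
N^(-1/d): it bounds the infinity-Wasserstein distance, and W2 a fortiori.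

Cut the torus into cubes of side s = 1/n. The excess of a cube is the number of
points of the sequence in it, minus N s^d. Suppose that the excess is the
divergence of a flux between neighbouring cubes which is bounded by a small
multiple of the number of points in each cube. Then each cube can send its flux
to its neighbours in a single step, after which all cubes hold the same mass,
which is spread uniformly inside each of them; every piece of mass has moved by
O(s) ([transport]). With s of order N^(-1/d) this is the theorem, and it remains
to bound the flux. Fluxes are better than couplings because they form a vector
space: they can be averaged and added without loss, see [bounded_div].

Bad approximability is used through two facts. The multiples of alpha are
separated, so that a cube of side 1/n holds boundedly many of the first O(n^d)
points ([separation]). And the orbit reaches every place of the torus, up to
O(1/n), in time O(n^d) ([orbit_covers]). If q is a return time, that is, if
q alpha is within 1/n of an integer vector, then the segment of length q of the
orbit is, up to a bounded flux, invariant under translations by multiples of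
alpha, hence under all translations; averaging over translations shows that its
excess has a bounded flux ([block_flux]). By Dirichlet's theorem there is such a
q of order n^d.

A general segment is treated by induction over the dyadic scales
([dyadic_flux]): it is made of boundedly many such blocks and a remainder that
is short enough to be handled with cubes of twice the side. To come back to the
smaller cubes, the flux through a face of side 2s is distributed over the
2^(d-1) faces of side s it contains, which divides it by 2^(d-1) >= 2 when
d >= 2, at the price of a bounded additional flux inside the cubes
([discrepancy_refine]). The fluxes of all the scales therefore add up to a
geometric series and the flux is bounded by a constant at the scale N^(-1/d).
Finally, grouping 2^m cubes in each direction multiplies the flux by 2^(m (d-1))
and the mass by 2^(m d) ([discrepancy_coarsen]); a constant m makes the flux as
small compared with the mass as [transport] requires. *)

Set Implicit Arguments.
Unset Strict Implicit.
Unset Printing Implicit Defensive.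

Import Order.TTheory GRing.Theory Num.Theory.
Import numFieldNormedType.Exports.

Local Open Scope classical_set_scope.
Local Open Scope ring_scope.

(** * Periodic arcs and cubes *)

Section cubes.
Context {R : realType}.

Implicit Types s t x : R.

Definition flr (x : R) : R := (Num.floor x)%:~R.

Lemma flr_le x : flr x <= x.
Proof. exact: floor_le. Qed.

Lemma lt_flr1 x : x < flr x + 1.
Proof. by have := floorD1_gt x; rewrite intrD. Qed.

Lemma flrD x z : z \is a Num.int -> flr (x + z) = flr x + z.
Proof. by move=> zZ; rewrite /flr floorDrz// intrD (floorK zZ). Qed.

Lemma flr_int x : flr x \is a Num.int.
Proof. exact: intr_int. Qed.

Lemma ler_flr x y : x <= y -> flr x <= flr y.
Proof. by move=> xy; rewrite /flr ler_int le_floor. Qed.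

Lemma flr_gap x y : flr x < flr y -> flr x + 1 <= flr y.
Proof. by rewrite /flr ltr_int -(intrD _ _ 1) ler_int lezD1. Qed.

Lemma flr_uniq x z : z \is a Num.int -> z <= x -> x < z + 1 -> flr x = z.
Proof.
move=> /intrP[m ->] h1 h2; rewrite /flr (@floor_def _ x m)//.
by rewrite h1 intrD.
Qed.

(** For 0 <= s <= 1 this is the indicator of the arc [0, s) modulo 1. Writing it
as a difference of two integer parts turns it into a discrete derivative: this
is what makes the fluxes of [move_flux] explicit. *)
Definition arc_ind (s x : R) : R := flr x - flr (x - s).

Lemma arc_indD s x z : z \is a Num.int -> arc_ind s (x + z) = arc_ind s x.
Proof.
by move=> zZ; rewrite /arc_ind (addrAC x z) (flrD _ zZ) (flrD _ zZ); lra.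
Qed.

Lemma arc_ind1 x : arc_ind 1 x = 1.
Proof. by rewrite /arc_ind flrD ?rpredN ?rpred1//; lra. Qed.

Lemma arc_ind_add s t x : arc_ind (s + t) x = arc_ind s x + arc_ind t (x - s).
Proof. by rewrite /arc_ind opprD addrA; lra. Qed.

Lemma arc_indE s x : 0 <= s <= 1 -> arc_ind s x = (x - flr x < s)%R%:R.
Proof.
move=> /andP[s0 s1]; rewrite /arc_ind.
have h1 := flr_le x; have h2 := lt_flr1 x.
case: ltP => h.
  rewrite (@flr_uniq (x - s) (flr x - 1)) ?rpredB ?flr_int ?rpred1 ?mulr1n//; lra.
rewrite (@flr_uniq (x - s) (flr x)) ?flr_int ?mulr0n//; lra.
Qed.

Lemma arc_ind_ge0 s x : 0 <= s <= 1 -> 0 <= arc_ind s x.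
Proof. by move=> s01; rewrite arc_indE// ler0n. Qed.

Lemma arc_ind_le1 s x : 0 <= s <= 1 -> arc_ind s x <= 1.
Proof. by move=> s01; rewrite arc_indE// lern1 leq_b1. Qed.

Lemma arc_ind_neq0 s x : 0 <= s <= 1 -> arc_ind s x != 0 ->
  arc_ind s x = 1 /\ 0 <= x - flr x < s.
Proof.
move=> s01; rewrite arc_indE//; case: ltP => [h _|_]; last by rewrite eqxx.
by split; [rewrite mulr1n|have := flr_le x; move: h; lra].
Qed.

(** Consecutive arcs of length 1/n tile the circle; the integer parts
telescope. *)
Lemma sum_arc_ind n (s x : R) : s *+ n = 1 ->
  \sum_(r < n) arc_ind s (x - s *+ r) = 1.
Proof.
move=> sn.
have := @telescope_sumr _ 0 n (fun r => - flr (x - s *+ r)) (leq0n _).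
rewrite big_mkord mulr0n subr0 sn flrD ?rpredN ?rpred1//.
rewrite (_ : - (flr x + -1) - - flr x = 1); last by lra.
move=> <-; apply: eq_bigr => r _; rewrite /arc_ind mulrSr opprD addrA; lra.
Qed.

Context {d : nat}.
Implicit Types u v y z : 'rV[R]_d.

(** The indicator, in u, of the cube y + [0, s)^d modulo 1. The corner y ranges
over all real vectors and not only over a grid, so that grids of different
positions and sizes can be compared by plain translations. *)
Definition cube_ind s u y : R := \prod_(i < d) arc_ind s (u ord0 i - y ord0 i).

Definition axis (k : nat) : 'rV[R]_d := \row_i (i == k :> nat)%:R.

Definition mod1_close (r : R) u : Prop :=
  exists2 z, z \in @int_lattice R d & forall i, `|u ord0 i - z ord0 i| <= r.

Definition lattice_periodic (g : 'rV[R]_d -> R) :=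
  forall y z, z \in @int_lattice R d -> g (y + z) = g y.

Lemma latticeP z :
  reflect (forall i, z ord0 i \is a Num.int) (z \in @int_lattice R d).
Proof. exact: forallP. Qed.

Lemma cube_ind_periodic s u : lattice_periodic (cube_ind s u).
Proof.
move=> y z /latticeP zZ; apply: eq_bigr => i _.
by rewrite mxE opprD addrA (@arc_indD s (_ - _) (- z ord0 i))// rpredN.
Qed.

Lemma cube_indD s u v y : cube_ind s (u + v) y = cube_ind s u (y - v).
Proof. by apply: eq_bigr => i _; rewrite !mxE; congr arc_ind; lra. Qed.

Lemma cube_ind_lattice s u z y : z \in @int_lattice R d ->
  cube_ind s (u + z) y = cube_ind s u y.
Proof. by move=> zZ; rewrite cube_indD cube_ind_periodic//; apply: rpredNr. Qed.

Lemma cube_ind_ge0 s u y : 0 <= s <= 1 -> 0 <= cube_ind s u y.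
Proof. by move=> s01; apply: prodr_ge0 => i _; exact: arc_ind_ge0. Qed.

Lemma cube_ind_neq0 s u y : 0 <= s <= 1 -> cube_ind s u y != 0 ->
  cube_ind s u y = 1 /\ exists2 z, z \in @int_lattice R d &
    forall i, 0 <= u ord0 i - y ord0 i - z ord0 i < s.
Proof.
move=> s01 /prodf_neq0 h; split.
  by apply: big1 => i _; case: (arc_ind_neq0 s01 (h i isT)).
exists (\row_i flr (u ord0 i - y ord0 i)).
  by apply/latticeP => i; rewrite mxE flr_int.
by move=> i; rewrite mxE; case: (arc_ind_neq0 s01 (h i isT)).
Qed.

Lemma cube_ind_eq1 s u y z : 0 <= s <= 1 -> z \in @int_lattice R d ->
  (forall i, 0 <= u ord0 i - y ord0 i - z ord0 i < s) -> cube_ind s u y = 1.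
Proof.
move=> s01 /latticeP zZ h; apply: big1 => i _; rewrite arc_indE//.
have /andP[h1 h2] := h i.
by rewrite (@flr_uniq _ (z ord0 i)) ?h2//; lra.
Qed.

(** Whatever the corner y, the n^d translates of a cube of side 1/n tile the
torus. Averaging over these translates replaces any counting function by a
constant, which is how exact equidistribution enters the proof. *)
Lemma sum_cube_ind n s u y : s *+ n = 1 ->
  \sum_(r : {ffun 'I_d -> 'I_n})
    cube_ind s u (y + \row_i (s *+ r i)) = 1.
Proof.
move=> sn; rewrite /cube_ind.
under eq_bigr do under eq_bigr do rewrite !mxE opprD addrA.
rewrite -(bigA_distr_bigA
  (fun i (r : 'I_n) => arc_ind s (u ord0 i - y ord0 i - s *+ r))).
by apply: big1 => i _; exact: sum_arc_ind.
Qed.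

End cubes.

(** * Bounded discrete divergences *)

Section divergence.
Context {R : realType} {d : nat}.
Implicit Types (u v y z : 'rV[R]_d) (s K rho : R) (g : 'rV[R]_d -> R).

(** A function g of the corner of a cube is an excess of mass that can be removed
by exchanges between neighbouring cubes of side s: F k y is the mass that flows
from the cube at y to the cube at y - s e_k. Unlike couplings, such fluxes can
be added, averaged and translated. *)
Definition bounded_div s K g : Prop :=
  exists F : 'I_d -> 'rV[R]_d -> R,
  [/\ forall k, lattice_periodic (F k),
      forall k y, `|F k y| <= K &
      forall y, g y = \sum_(k < d) (F k y - F k (y + s *: axis k))].

Lemma bounded_div_eq s K g g' :
  g =1 g' -> bounded_div s K g -> bounded_div s K g'.
Proof. by move=> e [F [h1 h2 h3]]; exists F; split=> // y; rewrite -e. Qed.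

Lemma bounded_div_le s K K' g :
  K <= K' -> bounded_div s K g -> bounded_div s K' g.
Proof.
by move=> e [F [h1 h2 h3]]; exists F; split=> // k y; exact: le_trans (h2 k y) e.
Qed.

Lemma bounded_div0 s : bounded_div s 0 (fun=> 0).
Proof.
exists (fun _ _ => 0); split=> //; first by move=> *; rewrite normr0.
by move=> y; rewrite big1// => *; rewrite subr0.
Qed.

Lemma bounded_divD s K K' g g' : bounded_div s K g -> bounded_div s K' g' ->
  bounded_div s (K + K') (fun y => g y + g' y).
Proof.
move=> [F [h1 h2 h3]] [F' [h1' h2' h3']].
exists (fun k y => F k y + F' k y); split.
- by move=> k y z zZ; rewrite h1// h1'.
- by move=> k y; rewrite (le_trans (ler_normD _ _))// lerD.
- move=> y; rewrite h3 h3' -big_split; apply: eq_bigr => k _ /=; lra.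
Qed.

Lemma bounded_divZ s K g a : bounded_div s K g ->
  bounded_div s (`|a| * K) (fun y => a * g y).
Proof.
move=> [F [h1 h2 h3]]; exists (fun k y => a * F k y); split.
- by move=> k y z zZ; rewrite h1.
- by move=> k y; rewrite normrM ler_wpM2l.
- by move=> y; rewrite h3 mulr_sumr; apply: eq_bigr => k _; rewrite mulrBr.
Qed.

Lemma bounded_div_shift s K g v : bounded_div s K g ->
  bounded_div s K (fun y => g (y + v)).
Proof.
move=> [F [h1 h2 h3]]; exists (fun k y => F k (y + v)); split=> //.
- by move=> k y z zZ; rewrite addrAC (h1 _ _ z zZ).
- by move=> y; rewrite h3; apply: eq_bigr => k _; rewrite addrAC.
Qed.

Lemma bounded_div_sum (I : Type) (r : seq I) s K (g : I -> 'rV[R]_d -> R) :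
  (forall i, bounded_div s K (g i)) ->
  bounded_div s (K *+ size r) (fun y => \sum_(i <- r) g i y).
Proof.
move=> h; elim: r => [|i r IH].
  by apply: bounded_div_eq (bounded_div0 s) => y; rewrite big_nil.
rewrite mulrS; apply: bounded_div_eq (bounded_divD (h i) IH) => y.
by rewrite big_cons.
Qed.

(** The factors are exchanged one at a time, by increasing index. *)
Lemma prod_telescope (a b : 'I_d -> R) :
  \prod_i a i - \prod_i b i =
  \sum_(k < d) (a k - b k) *
    \prod_(i | i != k) (if (i < k)%N then b i else a i).
Proof.
pose h k := \prod_(i < d) (if (i < k)%N then b i else a i).
have -> : \prod_i a i = h 0%N by apply: eq_bigr.
have -> : \prod_i b i = h d by apply: eq_bigr => i _; rewrite ltn_ord.
rewrite -opprB -telescope_sumr// big_mkord -sumrN; apply: eq_bigr => k _.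
rewrite /h (bigD1 k)//= [X in _ - X](bigD1 k)//= ltnS leqnn ltnn.
rewrite opprB mulrBl; congr (_ * _ - _ * _).
apply: eq_bigr => i ik; rewrite ltnS leq_eqVlt.
by case: eqP => // e; move: ik; rewrite (ord_inj e) eqxx.
Qed.

Lemma flr_move (x e : R) : flr x != flr (x + e) ->
  `|flr x - flr (x + e)| <= `|e| + 1 /\
  exists2 z, z \is a Num.int & `|x - z| <= `|e|.
Proof.
have h1 := flr_le x; have h2 := lt_flr1 x.
have h3 := flr_le (x + e); have h4 := lt_flr1 (x + e).
case: (ltgtP (flr x) (flr (x + e))) => // h _.
  have h5 := flr_gap h; have e0 : 0 < e by lra.
  rewrite (gtr0_norm e0); split; first by rewrite ler0_norm; lra.
  exists (flr (x + e)); first exact: flr_int.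
  by rewrite ler0_norm; lra.
have h5 := flr_gap h; have e0 : e < 0 by lra.
rewrite (ltr0_norm e0); split; first by rewrite ger0_norm; lra.
exists (flr x); first exact: flr_int.
by rewrite ger0_norm; lra.
Qed.

(** The flux that realizes the displacement of a point from u to u + v along the
coordinate axes, one coordinate after the other. Its k-th component counts,
with sign, how many times the k-th leg of the path crosses the face of the cube
at y. *)
Definition move_flux s u v (k : 'I_d) y : R :=
  (flr (u ord0 k - y ord0 k) - flr (u ord0 k - y ord0 k + v ord0 k)) *
  \prod_(i < d | i != k)
     arc_ind s (if (i < k)%N then u ord0 i - y ord0 i + v ord0 i
                else u ord0 i - y ord0 i).

Lemma move_flux_periodic s u v k : lattice_periodic (move_flux s u v k).
Proof.
move=> y z /latticeP zZ; have zN i : - z ord0 i \is a Num.int by rewrite rpredN.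
congr (_ * _).
  by rewrite mxE opprD !addrA (addrAC _ (- z _ _)) !(flrD _ (zN k)); lra.
apply: eq_bigr => i _; rewrite !mxE opprD !addrA.
by case: ifP => _; rewrite ?[_ - z _ _ + v _ _]addrAC (arc_indD s _ (zN i)).
Qed.

Lemma move_fluxE s u v y :
  cube_ind s u y - cube_ind s (u + v) y =
  \sum_(k < d) (move_flux s u v k y - move_flux s u v k (y + s *: axis k)).
Proof.
rewrite /cube_ind prod_telescope; apply: eq_bigr => k _.
rewrite /move_flux !mxE eqxx mulr1.
under [X in _ = _ - _ * X]eq_bigr => i ik.
  have ik' : (i == k :> nat) = false by apply: negbTE.
  rewrite !mxE ik' mulr0 addr0; over.
rewrite -mulrBl; congr (_ * _); last first.
  by apply: eq_bigr => i _; case: ifP => // _; rewrite !mxE; congr arc_ind; lra.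
rewrite /arc_ind (_ : u ord0 k + v ord0 k - y ord0 k =
  u ord0 k - y ord0 k + v ord0 k); last by lra.
rewrite (_ : u ord0 k - (y ord0 k + s) = u ord0 k - y ord0 k - s); last by lra.
rewrite (addrAC _ (- s)); lra.
Qed.

(** The path from u to u + v only meets cubes close to u, and crosses each face a
bounded number of times. *)
Lemma move_flux_le s rho u v k y : 0 <= s <= 1 -> 0 <= rho ->
  (forall i, `|v ord0 i| <= rho * s) ->
  `|move_flux s u v k y| <=
    (rho + 1) * `[< mod1_close ((rho + 1) * s) (u - y) >]%:R.
Proof.
move=> s01 rho0 hv; have /andP[s0 s1] := s01.
have [->|] := eqVneq (move_flux s u v k y) 0.
  by rewrite normr0 mulr_ge0// addr_ge0.
rewrite mulf_eq0 negb_or subr_eq0 => /andP[/flr_move[h1 [zk zkZ hzk]]].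
move=> /prodf_neq0 h2.
have hs : rho * s <= (rho + 1) * s by rewrite ler_wpM2r// lerDl.
have -> : `[< mod1_close ((rho + 1) * s) (u - y) >] = true.
  apply/asboolP; exists (\row_i if i == k then zk else
      flr (if (i < k)%N then u ord0 i - y ord0 i + v ord0 i
           else u ord0 i - y ord0 i)).
    by apply/latticeP => i; rewrite mxE; case: ifP => // _; exact: flr_int.
  move=> i; rewrite !mxE; have := hv i; rewrite ler_norml => /andP[v1 v2].
  case: eqP => [->|/eqP/h2/(arc_ind_neq0 s01)[_]].
    exact: le_trans (le_trans hzk (hv k)) hs.
  rewrite ler_norml => /andP[]; case: ifP => _ h3 h4; nra.
rewrite mulr1 normrM -[leRHS]mulr1 ler_pM//.
  apply: (le_trans h1); rewrite lerD2r (le_trans (hv k))// -[leRHS]mulr1.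
  by rewrite ler_wpM2l.
by rewrite ger0_norm ?prodr_ge0 ?prodr_ile1// => i _;
  rewrite ?arc_ind_ge0 ?arc_ind_le1.
Qed.

Lemma cube_ind_le_close s u y : 0 <= s <= 1 ->
  cube_ind s u y <= `[< mod1_close s (u - y) >]%:R.
Proof.
move=> s01.
have [->//|/(cube_ind_neq0 s01)[-> [z zZ h]]] := eqVneq (cube_ind s u y) 0.
suff -> : `[< mod1_close s (u - y) >] = true by [].
apply/asboolP; exists z => // i; have /andP[h1 h2] := h i; rewrite !mxE.
by rewrite ger0_norm// ltW.
Qed.

(** When few of the points p i are close to any given place, few of the paths from
p i to p i + v cross a given face, so that the total flux stays bounded however
many points move. *)
Lemma bounded_div_move (I : finType) (p : I -> 'rV[R]_d) s rho (L : nat) v :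
  0 <= s <= 1 -> 0 <= rho -> (forall i, `|v ord0 i| <= rho * s) ->
  (forall y,
    #|[set i | `[< mod1_close ((rho + 1) * s) (p i - y) >]]%SET| <= L)%N ->
  bounded_div s ((rho + 1) * L%:R)
    (fun y => \sum_i (cube_ind s (p i) y - cube_ind s (p i + v) y)).
Proof.
move=> s01 rho0 hv hL.
exists (fun k y => \sum_i move_flux s (p i) v k y); split.
- by move=> k y z zZ; apply: eq_bigr => i _; rewrite move_flux_periodic.
- move=> k y; apply: (le_trans (ler_norm_sum _ _ _)).
  apply: le_trans
    (ler_sum _ (fun i _ => move_flux_le (p i) k y s01 rho0 hv)) _.
  rewrite -mulr_sumr ler_wpM2l ?addr_ge0// -natr_sum ler_nat.
  apply: leq_trans (hL y); rewrite -sum1_card [leqRHS]big_mkcond.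
  by apply: leq_sum => i _; rewrite inE; case: asboolP.
- move=> y; under eq_bigr do rewrite move_fluxE.
  by rewrite exchange_big; apply: eq_bigr => k _; rewrite -sumrB.
Qed.

End divergence.

(** * Separation and covering by multiples of a vector *)

Section closeness.
Context {R : realType} {d : nat}.
Implicit Types (u v y z : 'rV[R]_d) (r s K rho X : R).

Lemma mod1_close_le r s u : r <= s -> mod1_close r u -> mod1_close s u.
Proof. by move=> rs [z zZ h]; exists z => // i; exact: le_trans (h i) rs. Qed.

Lemma mod1_closeN r u : mod1_close r u -> mod1_close r (- u).
Proof.
move=> [z zZ h]; exists (- z); first by rewrite rpredN.
by move=> i; rewrite !mxE -opprD normrN.
Qed.

Lemma mod1_closeZ r u (n : nat) :
  mod1_close r u -> mod1_close (n%:R * r) (n%:R *: u).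
Proof.
move=> [z zZ h]; exists (n%:R *: z); first by rewrite scaler_nat rpredMn.
by move=> i; rewrite !mxE -mulrBr normrM normr_nat ler_wpM2l.
Qed.

(** Cut the unit cube into L^d cells; two points share one. *)
Lemma pigeonhole_cube (I : finType) (w : I -> 'rV[R]_d) (L : nat) : (0 < L)%N ->
  (forall i j, 0 <= w i ord0 j < 1) -> (L ^ d < #|I|)%N ->
  exists i, exists2 i', i != i' &
    forall j, `|w i ord0 j - w i' ord0 j| < L%:R^-1.
Proof.
case: L => // L _ w01 cI.
have L0 : 0 < L.+1%:R :> R by rewrite ltr0n.
pose cell i j := L.+1%:R * w i ord0 j.
pose f i : {ffun 'I_d -> 'I_L.+1} :=
  [ffun j => inord (Num.trunc (cell i j))].
have : ~~ injectiveb f.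
  apply/negP => /injectiveP/leq_card.
  by rewrite card_ffun !card_ord leqNgt cI.
move=> /injectivePn[i [i' ii' fii']]; exists i, i' => // j.
have cell0 k : 0 <= cell k j by rewrite mulr_ge0//; case/andP: (w01 k j).
have e k : (f k j)%:R <= cell k j < (f k j)%:R + 1.
  rewrite ffunE inordK; first by have := truncn_itv (cell0 k); rewrite -natr1.
  have /andP[h1 h2] := truncn_itv (cell0 k).
  rewrite -(ltr_nat R); apply: (le_lt_trans h1).
  by rewrite -[ltRHS]mulr1 ltr_pM2l//; case/andP: (w01 k j).
have /andP[h1 h2] := e i; have := e i'; rewrite -fii' => /andP[h3 h4].
rewrite -(ltr_pM2l L0) mulfV ?gt_eqF// -[X in X * _](gtr0_norm L0) -normrM.
by rewrite mulrBr ltr_norml; move: h1 h2 h3 h4; rewrite /cell; lra.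
Qed.

Lemma pigeonhole_mod1 (I : finType) (p : I -> 'rV[R]_d) (L : nat) : (0 < L)%N ->
  (L ^ d < #|I|)%N ->
  exists i, exists2 i', i != i' & mod1_close L%:R^-1 (p i - p i').
Proof.
move=> L0 cI.
pose z i : 'rV[R]_d := \row_j flr (p i ord0 j).
have zZ i : z i \in @int_lattice R d.
  by apply/latticeP => j; rewrite mxE flr_int.
have w01 i j : 0 <= (p i - z i) ord0 j < 1.
  have := flr_le (p i ord0 j); have := lt_flr1 (p i ord0 j).
  by rewrite !mxE; lra.
have [i [i' ii' h]] := pigeonhole_cube L0 w01 cI.
exists i, i' => //; exists (z i - z i'); first exact: rpredB.
by move=> j; have := ltW (h j); rewrite !mxE; congr (`|_| <= _); lra.
Qed.

(** Bad approximability without roots or maxima: the multiples q alpha with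
0 < q <= X^d stay at distance at least 1 / (M X) from the lattice. *)
Definition separated_multiples (M : nat) (alpha : 'rV[R]_d) : Prop :=
  forall (q : nat) X rho, (0 < q)%N -> 0 < X -> q%:R <= X ^+ d ->
    mod1_close rho (q%:R *: alpha) -> 1 <= M%:R * rho * X.

Variables (M : nat) (alpha : 'rV[R]_d).
Hypothesis M_gt0 : (0 < M)%N.
Hypothesis sep_alpha : separated_multiples M alpha.

Lemma separated_sub (m i i' : nat) X rho : (i < m)%N -> (i' < m)%N -> i != i' ->
  0 < X -> m%:R <= X ^+ d -> mod1_close rho (i%:R *: alpha - i'%:R *: alpha) ->
  1 <= M%:R * rho * X.
Proof.
move=> im im' ii' X0 mX.
wlog lt : i i' im im' ii' / (i' < i)%N.
  move=> wl; move: (ii'); rewrite neq_lt => /orP[lt|lt]; last exact: wl.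
  by move=> /mod1_closeN; rewrite opprB; apply: wl => //; rewrite eq_sym.
rewrite -scalerBl -natrB ?(ltnW lt)//; apply: sep_alpha => //.
  by rewrite subn_gt0.
by apply: le_trans mX; rewrite ler_nat; lia.
Qed.

(** Two multiples of alpha in the same cell of a small cube would have a difference
that is too close to the lattice, so each cell holds at most one. *)
Lemma separation (m L : nat) (r X : R) (b : 'rV[R]_d) : (0 < L)%N -> 0 < X ->
  m%:R <= X ^+ d -> 0 <= r -> 2 * r * M%:R * X < L%:R ->
  (#|[set i : 'I_m | `[< mod1_close r (i%:R *: alpha - b) >]]%SET| <= L ^ d)%N.
Proof.
move=> L0 X0 mX r0 hL; set S := [set i | _]%SET; rewrite leqNgt.
apply/negP => cS.
have MX : 0 < M%:R * X by rewrite mulr_gt0// ltr0n.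
have LR : 0 < L%:R :> R by rewrite ltr0n.
have MX2 : 0 < 2 * (M%:R * X) by lra.
pose e := L%:R / (2 * (M%:R * X)); have re : r < e.
  by rewrite ltr_pdivlMr//; lra.
(* A radius r' > r puts the rescaled points in the half-open unit cube. *)
pose r' := (r + e) / 2; have rr' : r < r' by rewrite /r'; lra.
have r'e : r' < e by rewrite /r'; lra.
have /choice[z /all_and2[zZ hz]] : forall i : {i : 'I_m | i \in S}, exists z,
    z \in @int_lattice R d /\
    forall j, `|((val i)%:R *: alpha - b) ord0 j - z ord0 j| <= r.
  by case=> i /=; rewrite inE => /asboolP[z zZ h]; exists z.
pose w (i : {i : 'I_m | i \in S}) : 'rV[R]_d :=
  (2 * r')^-1 *: ((val i)%:R *: alpha - b - z i + const_mx r').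
have r'0 : 0 < 2 * r' by lra.
have w01 i j : 0 <= w i ord0 j < 1.
  rewrite mxE mulrC ler_pdivlMr// ltr_pdivrMr//.
  have := hz i j; rewrite !mxE mul0r mul1r ler_norml; lra.
have := @pigeonhole_cube _ w L L0 w01.
rewrite card_sig => /(_ cS)[i [i' ii' h]].
suff : 1 <= M%:R * (2 * r' / L%:R) * X.
  rewrite leNgt => /negP; apply; rewrite mulrAC mulrA ltr_pdivrMr// mul1r.
  by move: r'e; rewrite ltr_pdivlMr//; lra.
apply: (separated_sub (ltn_ord (val i)) (ltn_ord (val i'))) => //.
exists (z i - z i'); first exact: rpredB.
move=> j; have := h j; rewrite [w i _ _]mxE [w i' _ _]mxE -mulrBr normrM.
rewrite gtr0_norm ?invr_gt0// mulrC ltr_pdivrMr// mulrC => /ltW.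
by rewrite !mxE; congr (`|_| <= _); lra.
Qed.

(** Dirichlet's theorem gives a return time q <= n^d; separation of the multiples
of alpha forces q to be of order n^d as well. *)
Lemma dirichlet (n : nat) : (0 < n)%N -> exists q : nat,
  [/\ (0 < q <= n ^ d)%N, mod1_close n%:R^-1 (q%:R *: alpha) &
      (n ^ d < (2 * M) ^ d * q)%N].
Proof.
move=> n0.
have [|i [i' ii']] :=
    @pigeonhole_mod1 'I_(n ^ d).+1 (fun i => i%:R *: alpha) n n0.
  by rewrite card_ord.
wlog lt : i i' ii' / (i' < i)%N.
  move=> wl; move: (ii'); rewrite neq_lt => /orP[lt|lt]; last exact: wl.
  by move=> /mod1_closeN; rewrite opprB; apply: wl => //; rewrite eq_sym.
rewrite -scalerBl -natrB ?(ltnW lt)// => h; exists (i - i')%N.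
have q0 : (0 < i - i')%N by rewrite subn_gt0.
split=> //; first by rewrite q0/=; have := ltn_ord i; lia.
rewrite ltnNge; apply/negP => le.
have nR : 0 < n%:R :> R by rewrite ltr0n.
have MR : 0 < M%:R :> R by rewrite ltr0n.
have := @sep_alpha _ (n%:R / (2 * M%:R)) n%:R^-1 q0 _ _ h.
have -> : M%:R / n%:R * (n%:R / (2 * M%:R)) = 2^-1 :> R.
  by field; rewrite !gt_eqF.
rewrite divr_gt0 ?mulr_gt0// expr_div_n ler_pdivlMr ?exprn_gt0 ?mulr_gt0//.
rewrite -natrM -!natrX -natrM ler_nat mulnC => /(_ isT le); lra.
Qed.

Definition cover_const : nat := (2 * ((2 * M) ^ d)`!)%N.

(** Among the points j y + i alpha, with j <= J and i < n^d, two are very close by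
the pigeonhole principle, and their indices j differ because the multiples of
alpha are separated. So a bounded multiple jj y is close to a multiple of alpha,
and so is J! y, as jj divides J!. Choosing y = v / J! gives v itself. *)
Lemma orbit_covers (n : nat) v : (0 < n)%N -> exists2 t : nat,
  (t <= cover_const * n ^ d)%N &
  mod1_close (cover_const%:R / n%:R) (v - t%:R *: alpha).
Proof.
move=> n0; set J := ((2 * M) ^ d)%N.
(* Shifting v by S alpha makes the time t nonnegative. *)
pose S := (J`! * n ^ d)%N.
pose y := J`!%:R^-1 *: (v - S%:R *: alpha).
have J0 : J`!%:R != 0 :> R by rewrite pnatr_eq0 -lt0n fact_gt0.
have yE : J`!%:R *: y = v - S%:R *: alpha by rewrite scalerA mulfV// scale1r.
have nR : 0 < n%:R :> R by rewrite ltr0n.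
have MR : 0 < M%:R :> R by rewrite ltr0n.
have L0 : (0 < 2 * M * n)%N by rewrite !muln_gt0 M_gt0.
pose p (x : 'I_J.+1 * 'I_(n ^ d)) := x.1%:R *: y + x.2%:R *: alpha.
have [|[j i] [[j' i'] neq]] := @pigeonhole_mod1 _ p _ L0.
  by rewrite card_prod !card_ord expnMn -/J ltn_pmul2r// expn_gt0 n0.
wlog lt : j i j' i' neq / (j' < j)%N.
  move=> wl; case: (ltngtP j' j) => lt; first exact: wl.
    by move=> /mod1_closeN; rewrite opprB; apply: wl => //; rewrite eq_sym.
  have ejj' : j = j' by apply: val_inj.
  rewrite {}ejj' in neq *; have ii' : i != i'.
    by apply: contra neq => /eqP ->.
  rewrite /p/= opprD addrACA subrr add0r => h.
  have := separated_sub (ltn_ord i) (ltn_ord i') ii' nR _ h.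
  have -> : M%:R * (2 * M * n)%:R^-1 * n%:R = 2^-1 :> R.
    by rewrite !natrM; field; rewrite !gt_eqF.
  by rewrite natrX => /(_ (lexx _)); lra.
pose jj := (j - j')%N; have jj0 : (0 < jj)%N by rewrite subn_gt0.
have jjJ : (jj %| J`!)%N.
  by apply: dvdn_fact; rewrite jj0 /jj; have := ltn_ord j; lia.
pose c := (J`! %/ jj)%N; have cj : (c * jj)%N = J`! by rewrite divnK.
have cJ : (c <= J`!)%N by rewrite -cj leq_pmulr.
move=> /(mod1_closeZ c) h; exists (S + c * i' - c * i)%N.
  apply: leq_trans (leq_subr _ _) _.
  rewrite /cover_const -/J -mulnA mul2n -addnn leq_add2l.
  by apply: leq_mul => //; apply: ltnW.
have le : (c * i <= S + c * i')%N.
  apply: (@leq_trans S); last exact: leq_addr.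
  by apply: leq_mul => //; apply: ltnW.
have -> : v - (S + c * i' - c * i)%:R *: alpha =
    c%:R *: (p (j, i) - p (j', i')).
  rewrite /p/= natrB// natrD !(natrM _ c) opprD addrACA -scalerBl.
  rewrite -natrB ?(ltnW lt)// -/jj scalerDr scalerA -(natrM _ c jj) cj yE.
  by apply/rowP => k; rewrite !mxE; ring.
apply: mod1_close_le h; rewrite ler_pdivlMr// -mulrA.
have -> : (2 * M * n)%:R^-1 * n%:R = (2 * M)%:R^-1 :> R.
  by rewrite !natrM; field; rewrite !gt_eqF.
rewrite ler_pdivrMr ?ltr0n ?muln_gt0//.
rewrite -natrM ler_nat /cover_const -/J; apply: leq_trans cJ _.
by rewrite -mulnA mulnCA leq_pmulr// muln_gt0 muln_gt0 M_gt0.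
Qed.

End closeness.

(** * Changing the side of the cubes *)

Section box_sum.
Context {R : realType} {d : nat}.
Implicit Types (u v y z : 'rV[R]_d) (s K : R) (P : pred nat).
Implicit Types f : 'rV[R]_d -> R.

(** Sum of f over the corners of a box with two cells in each direction k selected
by P. For P full and k = d this passes from cubes of side s to cubes of side 2s;
omitting one direction gives a face of the larger cube. *)
Fixpoint box_sum s P k f y : R :=
  if k is k'.+1 then
    box_sum s P k' f y +
    (if P k' then box_sum s P k' f (y + s *: axis k') else 0)
  else f y.

Lemma eq_box_sum s P k f f' : f =1 f' -> box_sum s P k f =1 box_sum s P k f'.
Proof. by move=> e; elim: k => //= k IH y; rewrite !IH. Qed.

Lemma box_sum_sum (I : Type) (r : seq I) s P k (f : I -> 'rV[R]_d -> R) y :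
  box_sum s P k (fun y => \sum_(i <- r) f i y) y =
  \sum_(i <- r) box_sum s P k (f i) y.
Proof.
elim: k y => //= k IH y; rewrite big_split/= IH; congr (_ + _).
by case: ifP => _ //; rewrite big1.
Qed.

Lemma box_sumB s P k f f' y :
  box_sum s P k (fun y => f y - f' y) y = box_sum s P k f y - box_sum s P k f' y.
Proof. by elim: k y => //= k IH y; rewrite !IH; case: ifP => _; lra. Qed.

Lemma box_sum_shift s P k f v y :
  box_sum s P k (fun y => f (y + v)) y = box_sum s P k f (y + v).
Proof. by elim: k y => //= k IH y; rewrite !IH (addrAC y v). Qed.

Lemma box_sum_cst s k c y : box_sum s xpredT k (fun=> c) y = 2 ^+ k * c.
Proof. by elim: k y => //= [|k IH] y; rewrite ?mul1r// !IH exprS; lra. Qed.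

Lemma box_sum_periodic s P k f :
  lattice_periodic f -> lattice_periodic (box_sum s P k f).
Proof.
move=> pf; elim: k => //= k IH y z zZ; rewrite (IH y z zZ).
by rewrite (addrAC y z) (IH _ z zZ).
Qed.

Lemma box_sum_le s k f K y : (forall y, `|f y| <= K) ->
  `|box_sum s xpredT k f y| <= 2 ^+ k * K.
Proof.
move=> fK; elim: k y => /= [|k IH] y; first by rewrite mul1r.
rewrite (le_trans (ler_normD _ _))// exprS -mulrA mulr_natl mulr2n.
by rewrite lerD.
Qed.

Lemma box_sum_ge s k f K y : (forall y, K <= f y) ->
  2 ^+ k * K <= box_sum s xpredT k f y.
Proof.
move=> fK; elim: k y => [|k IH] y /=; first by rewrite mul1r.
by have := IH y; have := IH (y + s *: axis k); rewrite exprS; lra.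
Qed.

(** Omitting one direction saves a factor 2: a face of the doubled cube consists
of 2^(d-1) small faces. *)
Lemma box_sum_le_skip s j k f K y : (forall y, `|f y| <= K) ->
  `|box_sum s (predC1 j) k f y| <= 2 ^+ (k - (j < k)) * K.
Proof.
move=> fK; elim: k y => /= [|k IH] y; first by rewrite mul1r.
have K0 : 0 <= K by rewrite (le_trans _ (fK y)).
rewrite (le_trans (ler_normD _ _))//; case: (ltngtP j k) => jk.
- rewrite /= ltnS (ltnW jk) subSS subn0.
  have := IH y; have := IH (y + s *: axis k); rewrite jk => h1 h2.
  have -> : 2 ^+ k = 2 * 2 ^+ (k - true) :> R.
    by rewrite -exprS subn1 prednK// (leq_ltn_trans _ jk).
  lra.
- rewrite /= [(j < k.+1)%N]ltnS leqNgt jk/= subn0.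
  have := IH y; have := IH (y + s *: axis k).
  rewrite ltnNge ltnW//= subn0 exprS => h1 h2; lra.
- by have := IH y; rewrite -jk /= ltnn ltnSn subn0 subn1/= normr0; lra.
Qed.

Lemma box_sum_skip s j k f y : box_sum s xpredT k f y =
  box_sum s (predC1 j) k f y +
  (if (j < k)%N then box_sum s (predC1 j) k f (y + s *: axis j) else 0).
Proof.
elim: k y => /= [|k IH] y; first by rewrite addr0.
rewrite !IH; case: (ltngtP j k) => jk.
- by rewrite /= ltnS (ltnW jk) (addrAC y); lra.
- by rewrite /= [(j < k.+1)%N]ltnS leqNgt jk/=; lra.
- by rewrite jk /= ltnSn; lra.
Qed.

Lemma box_sum_cube s k u y : (k <= d)%N ->
  box_sum s xpredT k (cube_ind s u) y =
  \prod_(i < d)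
    arc_ind (if (i < k)%N then s + s else s) (u ord0 i - y ord0 i).
Proof.
elim: k y => //= k IH y kd; rewrite !IH ?(ltnW kd)//.
pose j := Ordinal kd.
rewrite (bigD1 j)//= [X in _ + X](bigD1 j)//= [RHS](bigD1 j)//= ltnn ltnSn.
rewrite !mxE eqxx mulr1.
have -> : \prod_(i < d | i != j) arc_ind (if (i < k)%N then s + s else s)
              (u ord0 i - (y + s *: axis k) ord0 i) =
   \prod_(i < d | i != j)
     arc_ind (if (i < k.+1)%N then s + s else s) (u ord0 i - y ord0 i).
  apply: eq_bigr => i ij; have ik : (i == k :> nat) = false by apply: negbTE.
  by rewrite !mxE ik mulr0 addr0 [(i < k.+1)%N]ltnS [(i <= k)%N]leq_eqVlt ik.
have -> : \prod_(i < d | i != j)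
     arc_ind (if (i < k)%N then s + s else s) (u ord0 i - y ord0 i) =
   \prod_(i < d | i != j)
     arc_ind (if (i < k.+1)%N then s + s else s) (u ord0 i - y ord0 i).
  apply: eq_bigr => i ij; have ik : (i == k :> nat) = false by apply: negbTE.
  by rewrite [(i < k.+1)%N]ltnS [(i <= k)%N]leq_eqVlt ik.
rewrite -mulrDl arc_ind_add; congr ((_ + arc_ind _ _) * _); lra.
Qed.

End box_sum.

(** * Discrepancy of the orbit in cubes *)

Section count.
Context {R : realType} {d : nat}.
Implicit Types (u v y z : 'rV[R]_d) (s K : R).
Variables (M : nat) (alpha : 'rV[R]_d).

Definition cube_count s m y : R := \sum_(i < m) cube_ind s (i%:R *: alpha) y.

Definition discrepancy s m y : R := cube_count s m y - m%:R * s ^+ d.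

Lemma cube_count_periodic s m : lattice_periodic (cube_count s m).
Proof. by move=> y z zZ; apply: eq_bigr => i _; rewrite cube_ind_periodic. Qed.

(** The orbit from time m on is the orbit from time 0 translated by m alpha. *)
Lemma cube_count_cat s m m' y : cube_count s (m + m') y =
  cube_count s m y + cube_count s m' (y - m%:R *: alpha).
Proof.
rewrite /cube_count big_split_ord/=; congr (_ + _); apply: eq_bigr => i _.
by rewrite -cube_indD natrD scalerDl addrC.
Qed.

Lemma cube_count_ge0 s m y : 0 <= s <= 1 -> 0 <= cube_count s m y.
Proof. by move=> s01; apply: sumr_ge0 => i _; exact: cube_ind_ge0. Qed.

Lemma cube_count1 m y : cube_count 1 m y = m%:R.
Proof.
rewrite /cube_count -[m in RHS]card_ord -sumr_const; apply: eq_bigr => i _.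
by apply: big1 => j _; rewrite arc_ind1.
Qed.

Lemma box_sum_count s m y :
  box_sum s xpredT d (cube_count s m) y = cube_count (s + s) m y.
Proof.
rewrite /cube_count box_sum_sum; apply: eq_bigr => i _; rewrite box_sum_cube//.
by apply: eq_bigr => j _; rewrite ltn_ord.
Qed.

(** An orbit segment is a concatenation of translated segments, and bounded
divergences are insensitive to translations. *)
Lemma bounded_div_blocks s K K' a q m :
  bounded_div s K (discrepancy s q) -> bounded_div s K' (discrepancy s m) ->
  bounded_div s (K *+ a + K') (discrepancy s (a * q + m)).
Proof.
move=> hq hm; elim: a => [|a IH]; first by rewrite mul0n add0n add0r.
rewrite mulrS -addrA mulSn -addnA.
have IH' := bounded_div_shift (- (q%:R *: alpha)) IH.
apply: bounded_div_eq (bounded_divD hq IH') => y.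
by rewrite /discrepancy (cube_count_cat s q) natrD; ring.
Qed.

Lemma exprDD s : (s + s) ^+ d = 2 ^+ d * s ^+ d.
Proof. by rewrite -exprMn; congr (_ ^+ _); lra. Qed.

(** First replace the content of each small cube by the mean over the large cube
that starts there: the successive averages over two neighbours telescope, and
their fluxes are controlled by the number of points in a small cube. Then
realize the flux K through a large face by translating the spread mass: it is
distributed over 2^(d-1) small faces. The factor 2^(1-d) is at most 1/2 because
d >= 2, and this contraction is what makes the induction over scales close
without a logarithm. *)
Lemma discrepancy_refine s K (C0 : R) m : (1 < d)%N -> 0 <= C0 ->
  (forall y, `|cube_count s m y| <= C0) ->
  bounded_div (s + s) K (discrepancy (s + s) m) ->
  bounded_div s (K / 2 + C0) (discrepancy s m).
Proof.
move=> d2 C00 hC [F [h1 h2 h3]].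
have p20 k : (2 ^+ k : R) != 0 by rewrite expf_eq0 pnatr_eq0 andbF.
have g20 k : 0 < (2 ^+ k : R) by rewrite exprn_gt0.
pose f := cube_count s m; pose S k := box_sum s xpredT k f.
(* The mean over the first k directions is S k y / 2^k. *)
have D1 : bounded_div s C0 (fun y => f y - (2 ^+ d)^-1 * S d y).
  exists (fun k y => (2 ^+ k.+1)^-1 * S k y); split.
  - by move=> k y z zZ; rewrite /S/=
      (box_sum_periodic _ _ _ (cube_count_periodic s m) _ zZ).
  - move=> k y; rewrite normrM normfV (gtr0_norm (g20 _)) ler_pdivrMl//.
    apply: le_trans (box_sum_le s k y hC) _; rewrite ler_wpM2r// exprS.
    by rewrite ler_peMl ?(ltW (g20 _))// ler1n.
  - move=> y; pose h k := - ((2 ^+ k)^-1 * S k y).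
    transitivity (h d - h 0%N).
      by rewrite /h expr0 invr1 mul1r opprK addrC.
    rewrite -telescope_sumr// big_mkord; apply: eq_bigr => k _.
    rewrite /h (_ : S k.+1 y = S k y + S k (y + s *: axis k))// !exprS.
    by move: (2 ^+ k) (p20 k) => p p0; field.
have D2 : bounded_div s (K / 2)
    (fun y => (2 ^+ d)^-1 * discrepancy (s + s) m y).
  exists (fun k y => (2 ^+ d)^-1 * (F k y + F k (y + s *: axis k))); split.
  - by move=> k y z zZ; rewrite (h1 k _ z zZ) (addrAC y z) (h1 k _ z zZ).
  - move=> k y; rewrite normrM normfV (gtr0_norm (g20 _)) ler_pdivrMl//.
    apply: le_trans (ler_normD _ _) _.
    have K0 : 0 <= K by rewrite (le_trans _ (h2 k y)).
    have := h2 k y; have := h2 k (y + s *: axis k).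
    have : 4 * K <= 2 ^+ d * K.
      rewrite ler_wpM2r// -natrX ler_nat.
      by rewrite -[leqLHS]/(2 ^ 2)%N leq_pexp2l.
    lra.
  - move=> y; rewrite h3 mulr_sumr; apply: eq_bigr => k _.
    by rewrite scalerDl !addrA; ring.
rewrite addrC; apply: bounded_div_eq (bounded_divD D1 D2) => y.
rewrite /S /f box_sum_count /discrepancy exprDD.
by move: (2 ^+ d) (p20 d) (s ^+ d) => p p0 q; field.
Qed.

(** Summing the flux over the 2^(d-1) small faces that make up a face of the
doubled cube; the inner fluxes cancel. Mass grows by 2^d in the meantime, hence
the flux becomes small relative to the mass. *)
Lemma discrepancy_coarsen s K m : bounded_div s K (discrepancy s m) ->
  bounded_div (s + s) (2 ^+ d.-1 * K) (discrepancy (s + s) m).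
Proof.
move=> [F [h1 h2 h3]].
exists (fun k y => box_sum s (predC1 (val k)) d (F k) y); split.
- by move=> k; exact: box_sum_periodic.
- move=> k y; have := box_sum_le_skip s k d y (h2 k).
  by rewrite ltn_ord subn1.
- move=> y; transitivity (box_sum s xpredT d (discrepancy s m) y).
    rewrite box_sumB box_sum_count box_sum_cst /discrepancy exprDD; lra.
  rewrite (eq_box_sum _ _ _ h3) box_sum_sum; apply: eq_bigr => k _.
  rewrite box_sumB box_sum_shift !(box_sum_skip s k) ltn_ord scalerDl addrA.
  lra.
Qed.

Lemma discrepancy_coarsen_iter s K m j : bounded_div s K (discrepancy s m) ->
  bounded_div (2 ^+ j * s) (2 ^+ (j * d.-1) * K) (discrepancy (2 ^+ j * s) m).
Proof.
move=> h; elim: j => [|j IH]; first by rewrite !mul1r.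
have := discrepancy_coarsen IH.
have -> : 2 ^+ j.+1 * s = 2 ^+ j * s + 2 ^+ j * s by rewrite exprS; lra.
by rewrite mulSn exprD -mulrA.
Qed.

Lemma cube_count_coarsen s m j L : (forall y, L <= cube_count s m y) ->
  forall y, 2 ^+ (j * d) * L <= cube_count (2 ^+ j * s) m y.
Proof.
move=> h; elim: j => [|j IH] y; first by rewrite !mul1r.
have -> : 2 ^+ j.+1 * s = 2 ^+ j * s + 2 ^+ j * s by rewrite exprS; lra.
by rewrite -box_sum_count mulSn exprD -mulrA; exact: box_sum_ge.
Qed.

Hypothesis M_gt0 : (0 < M)%N.
Hypothesis sep_alpha : separated_multiples M alpha.

(** Bounds the number of orbit points, among the first (B n)^d, within rho / n of
a point. *)
Definition sep_const (rho B : nat) : nat := ((2 * rho * B * M).+1 ^ d)%N.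

Definition move_const rho B : nat := (rho.+1 * sep_const rho.+1 B)%N.

Lemma sep_const_count (n B rho m : nat) y : (0 < n)%N -> (0 < B)%N ->
  (m <= (B * n) ^ d)%N ->
  (#|[set i : 'I_m | `[< mod1_close (rho%:R / n%:R) (i%:R *: alpha - y) >]]%SET|
    <= sep_const rho B)%N.
Proof.
move=> n0 B0 mB; have nR : 0 < n%:R :> R by rewrite ltr0n.
apply: (separation M_gt0 sep_alpha _ (X := (B * n)%:R)) => //.
- by rewrite ltr0n muln_gt0 B0.
- by rewrite -natrX ler_nat.
- rewrite -natr1 !natrM; set t := (X in X < _).
  suff -> : t = 2 * rho%:R * B%:R * M%:R by lra.
  by rewrite /t; field; rewrite gt_eqF.
Qed.

Lemma inv01 n : (0 < n)%N -> 0 <= (n%:R^-1 : R) <= 1.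
Proof. by move=> n0; rewrite invr_ge0 ler0n/= invf_le1 ?ler1n// ltr0n. Qed.

Lemma cube_count_le (n B m : nat) y : (0 < n)%N -> (0 < B)%N ->
  (m <= (B * n) ^ d)%N -> `|cube_count n%:R^-1 m y| <= (sep_const 1 B)%:R.
Proof.
move=> n0 B0 mB; rewrite ger0_norm ?cube_count_ge0 ?inv01//.
apply: le_trans (ler_sum _ (fun i _ => cube_ind_le_close _ y (inv01 n0))) _.
rewrite -natr_sum ler_nat -[n%:R^-1]mul1r.
apply: leq_trans (sep_const_count 1 y n0 B0 mB).
rewrite -sum1_card [leqRHS]big_mkcond.
by apply: leq_sum => i _; rewrite inE; case: asboolP.
Qed.

(** Covers the two short displacements of [block_flux], where v is q alpha or the
error in [orbit_covers], up to an integer vector. *)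
Lemma orbit_move (n B rho m : nat) v b : (0 < n)%N -> (0 < B)%N ->
  (m <= (B * n) ^ d)%N -> (forall i, `|v ord0 i| <= rho%:R / n%:R) ->
  bounded_div n%:R^-1 (move_const rho B)%:R (fun y =>
    \sum_(i < m) (cube_ind n%:R^-1 (i%:R *: alpha + b) y -
                  cube_ind n%:R^-1 (i%:R *: alpha + b + v) y)).
Proof.
move=> n0 B0 mB hv; rewrite /move_const natrM -natr1.
apply: (bounded_div_move (inv01 n0) (ler0n _ rho) hv) => y.
apply: leq_trans (sep_const_count rho.+1 (y - b) n0 B0 mB); rewrite -natr1.
rewrite (_ : finset _ = finset (fun i : 'I_m =>
  `[< mod1_close ((rho%:R + 1) / n%:R) (i%:R *: alpha - (y - b)) >])) //.
by apply/setP => i; rewrite !inE opprB addrA addrAC.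
Qed.

Definition block_const : nat :=
  (move_const 1 (@cover_const d M) + move_const (@cover_const d M) 1)%N.

(** If q alpha is within 1/n of the lattice, the segment of length q is almost
invariant under every translation. Indeed the segments [0, q) and [t, t + q)
differ by moving i alpha to (i + q) alpha for i < t, a short displacement, and
by [orbit_covers] any translation is close to the translation by some t alpha
with t of order n^d. Averaging over the translations of a grid of side 1/n makes
the count constant, by [sum_cube_ind]. *)
Lemma block_flux (n q : nat) : (0 < d)%N -> (0 < n)%N -> (q <= n ^ d)%N ->
  mod1_close n%:R^-1 (q%:R *: alpha) ->
  bounded_div n%:R^-1 block_const%:R (discrepancy n%:R^-1 q).
Proof.
move=> d0 n0 qn [z zZ hz]; set s := n%:R^-1; set C := @cover_const d M.
have nR : n%:R != 0 :> R by rewrite pnatr_eq0 -lt0n.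
have C0 : (0 < C)%N by rewrite /C /cover_const muln_gt0 fact_gt0.
(* Both segments are compared with the segment of length q that starts at t. *)
have main v : bounded_div s block_const%:R
    (fun y => cube_count s q y - cube_count s q (y + v)).
  have [t tC [z' z'Z hz']] := orbit_covers M_gt0 sep_alpha (- v) n0.
  have tB : (t <= (C * n) ^ d)%N.
    apply: leq_trans tC _; rewrite expnMn leq_mul2r; apply/orP; right.
    by rewrite -[leqLHS]expn1 leq_pexp2l.
  have D1 := @orbit_move n C 1 t (q%:R *: alpha - z) 0 n0 C0 tB.
  have D2 :=
    @orbit_move n 1 C q (- v - t%:R *: alpha - z') (t%:R *: alpha) n0 isT.
  rewrite /block_const natrD.
  apply: bounded_div_eq (bounded_divD (D1 _) (D2 _ _)); last 3 first.
  - by move=> i; rewrite !mxE mul1r; have := hz i; rewrite !mxE.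
  - by rewrite mul1n.
  - by move=> i; have := hz' i; rewrite !mxE.
  move=> y; rewrite !sumrB.
  under eq_bigr do rewrite addr0.
  under [X in _ - X + _]eq_bigr do
    rewrite addr0 addrA cube_ind_lattice ?rpredN// cube_indD.
  under [X in _ + (X - _)]eq_bigr do rewrite cube_indD.
  under [X in _ + (_ - X)]eq_bigr => i _.
    rewrite addrA cube_ind_lattice ?rpredN//.
    rewrite (_ : i%:R *: alpha + t%:R *: alpha + (- v - t%:R *: alpha) =
      i%:R *: alpha + - v); last by apply/rowP => k; rewrite !mxE; ring.
    rewrite cube_indD opprK; over.
  rewrite -/s -!/(cube_count _ _ _).
  by have := cube_count_cat s t q y; rewrite addnC cube_count_cat; lra.
pose v (r : {ffun 'I_d -> 'I_n}) : 'rV[R]_d := \row_i (s *+ r i).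
have := bounded_divZ (s ^+ d)
  (bounded_div_sum (index_enum _) (fun r => main (v r))).
have -> : size (index_enum {ffun 'I_d -> 'I_n}) = (n ^ d)%N.
  have := cardT {ffun 'I_d -> 'I_n}; rewrite card_ffun !card_ord enumT => ->.
  by rewrite /index_enum; case: index_enum_key.
have -> : `|s ^+ d| * (block_const%:R *+ n ^ d) = block_const%:R.
  rewrite ger0_norm ?exprn_ge0 ?invr_ge0// -[_ *+ _]mulr_natr mulrCA natrX.
  by rewrite -exprMn mulVf// expr1n mulr1.
apply: bounded_div_eq => y; rewrite sumrB sumr_const card_ffun !card_ord.
have -> : \sum_(r : {ffun 'I_d -> 'I_n}) cube_count s q (y + v r) = q%:R.
  rewrite exchange_big/= -[q in RHS]card_ord -sumr_const.
  apply: eq_bigr => i _.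
  by apply: sum_cube_ind; rewrite -[_ *+ _]mulr_natr mulVf.
rewrite /discrepancy -[_ *+ (n ^ d)]mulr_natr mulrBr mulrCA natrX -exprMn.
by rewrite mulVf// expr1n mulr1 mulrC.
Qed.

(** A segment of length of order n^d consists of boundedly many segments of a
length q given by [dirichlet], and a remainder of length at most n^d. *)
Lemma block_decomposition (n B m : nat) : (0 < d)%N -> (0 < n)%N ->
  (m <= (B * n) ^ d)%N -> exists a q m' : nat,
  [/\ m = (a * q + m')%N, (m' <= n ^ d)%N, (a <= (2 * B * M) ^ d)%N &
      bounded_div n%:R^-1 block_const%:R (discrepancy n%:R^-1 q)].
Proof.
move=> d0 n0 mB.
have [q [/andP[q0 qn] hq nq]] := dirichlet M_gt0 sep_alpha n0.
exists (m %/ q)%N, q, (m %% q)%N; split.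
- exact: divn_eq.
- by rewrite (leq_trans _ qn)// ltnW// ltn_pmod.
- rewrite -(leq_pmul2r q0); apply: leq_trans (leq_trunc_div m q) _.
  apply: (@leq_trans (B ^ d * ((2 * M) ^ d * q))).
    by rewrite (leq_trans mB)// expnMn leq_mul2l (ltnW nq) orbT.
  by rewrite mulnA -expnMn mulnCA mulnA.
- exact: block_flux.
Qed.

(** The fixed point of K = K / 2 + a + b, where a comes from the spreading in
[discrepancy_refine] and b from the blocks. *)
Definition dyadic_const : nat :=
  (2 * (sep_const 1 1 + (4 * M) ^ d * block_const))%N.

Lemma inv_pow2S k :
  (2 ^ k)%:R^-1 = (2 ^ k.+1)%:R^-1 + (2 ^ k.+1)%:R^-1 :> R.
Proof.
rewrite expnS natrM.
have : (2 ^ k)%:R != 0 :> R by rewrite pnatr_eq0 expn_eq0.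
by move=> ?; field.
Qed.

(** Induction over scales: at side 2^-(k+1) the segment splits into blocks and a
remainder short enough for side 2^-k; the flux of the remainder is halved by
[discrepancy_refine]. *)
Lemma dyadic_flux (k m : nat) : (1 < d)%N -> (m <= (2 * 2 ^ k) ^ d)%N ->
  bounded_div (2 ^ k)%:R^-1 dyadic_const%:R (discrepancy (2 ^ k)%:R^-1 m).
Proof.
move=> d2; elim: k m => [|k IH] m mk.
  apply: (bounded_div_le (ler0n _ _)).
  apply: bounded_div_eq (bounded_div0 _) => y.
  by rewrite /discrepancy expn0 invr1 cube_count1 expr1n mulr1 subrr.
have n0 : (0 < 2 ^ k.+1)%N by rewrite expn_gt0.
have [a [q [m' [-> m'n aB hq]]]] := block_decomposition (ltnW d2) n0 mk.
have h : bounded_div (2 ^ k.+1)%:R^-1 (dyadic_const%:R / 2 + (sep_const 1 1)%:R)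
           (discrepancy (2 ^ k.+1)%:R^-1 m').
  apply: discrepancy_refine => //.
    by move=> y; apply: cube_count_le; rewrite ?mul1n.
  by rewrite -inv_pow2S; apply: IH; rewrite -expnS.
apply: bounded_div_le (bounded_div_blocks a hq h).
have : block_const%:R *+ a <= ((4 * M) ^ d * block_const)%:R :> R.
  by rewrite -mulrnA ler_nat mulnC leq_mul2r aB orbT.
rewrite /dyadic_const; move: (block_const%:R *+ a) (_ * block_const)%N => x y.
by rewrite (natrM _ 2%N) (natrD _ (sep_const 1 1)); lra.
Qed.

Definition flux_const (B : nat) : nat :=
  ((2 * B * M) ^ d * block_const + dyadic_const)%N.

Lemma discrepancy_flux (k B m : nat) : (1 < d)%N -> (m <= (B * 2 ^ k) ^ d)%N ->
  bounded_div (2 ^ k)%:R^-1 (flux_const B)%:R (discrepancy (2 ^ k)%:R^-1 m).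
Proof.
move=> d2 mB; have n0 : (0 < 2 ^ k)%N by rewrite expn_gt0.
have [a [q [m' [-> m'n aB hq]]]] := block_decomposition (ltnW d2) n0 mB.
have h := @dyadic_flux k m' d2.
apply: bounded_div_le (bounded_div_blocks a hq (h _)); last first.
  by apply: leq_trans m'n _; rewrite leq_exp2r ?leq_pmull// ltnW.
rewrite /flux_const -mulrnA -natrD ler_nat leq_add2r mulnC leq_mul2r.
by rewrite aB orbT.
Qed.

Definition hitting_const : nat := (4 * @cover_const d M * @cover_const d M).+1%N.

(** Apply [orbit_covers] to the centre of the cube, at a scale such that the error
is a quarter of the side. *)
Lemma all_cubes_hit (n N : nat) y : (0 < d)%N -> (0 < n)%N ->
  ((hitting_const * n) ^ d <= N)%N -> 1 <= cube_count n%:R^-1 N y.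
Proof.
move=> d0 n0 hN; set C := @cover_const d M.
have C0 : (0 < C)%N by rewrite /C /cover_const muln_gt0 fact_gt0.
have nR : 0 < n%:R :> R by rewrite ltr0n.
have CR : 0 < C%:R :> R by rewrite ltr0n.
have n'0 : (0 < 4 * C * n)%N by rewrite muln_gt0 n0 andbT muln_gt0 C0.
have [t tC [z zZ hz]] :=
  orbit_covers M_gt0 sep_alpha (y + const_mx (2 * n%:R)^-1) n'0.
have tN : (t < N)%N.
  apply: leq_trans hN; apply: (leq_ltn_trans tC).
  apply: (@leq_ltn_trans ((C * (4 * C * n)) ^ d)).
    rewrite [leqRHS]expnMn leq_mul2r; apply/orP; right.
    by rewrite -[leqLHS]expn1 leq_pexp2l.
  rewrite ltn_exp2r// mulnA ltn_pmul2r// /hitting_const -/C ltnS.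
  by rewrite mulnC.
rewrite /cube_count (bigD1 (Ordinal tN))//= (@cube_ind_eq1 _ _ _ _ _ (- z))
  ?inv01// ?rpredN//.
  by rewrite lerDl sumr_ge0// => i _; rewrite cube_ind_ge0// inv01.
move=> i; have := hz i; rewrite !mxE.
have -> : C%:R / (4 * C * n)%:R = n%:R^-1 / 4 :> R.
  by rewrite !natrM; field; rewrite !gt_eqF.
have -> : (2 * n%:R)^-1 = n%:R^-1 / 2 :> R by field; rewrite gt_eqF.
have : 0 < n%:R^-1 :> R by rewrite invr_gt0.
by rewrite ler_norml; lra.
Qed.

End count.

(** * From weighted targets to a Wasserstein bound *)

Section torus_distance.
Context {R : realType} {d : nat}.

Lemma torus_dist_ge0 (x y : torus R d) : 0 <= torus_dist x y.
Proof.
rewrite /torus_dist; set S := [set _ | _ in _ & _ in _].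
have [->|/set0P S0] := eqVneq S set0; first by rewrite inf0.
by apply: lb_le_inf => // _ [u _ [v _ <-]]; exact: sqrtr_ge0.
Qed.

Lemma torus_dist_le (u v z : 'rV[R]_d) : z \in @int_lattice R d ->
  torus_dist (mod1 u) (mod1 v) <= euclidean_norm (u - v - z).
Proof.
move=> zZ; apply: ge_inf.
  by exists 0 => _ [u' _ [v' _ <-]]; exact: sqrtr_ge0.
exists u => //; exists (v + z); last by rewrite opprD addrA.
suff : (v + z = v %[mod Quotient.quot (@int_lattice R d)])%qT by [].
apply/eqmodP; change (Quotient.equiv (@int_lattice R d) (v + z) v).
by rewrite Quotient.equivE addrAC subrr add0r.
Qed.

End torus_distance.

Section coupling.
Import HBNNSimple.
Context {R : realType} {d : nat}.
Local Notation T := (torus R d).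

Definition pair_mod1 (x : T) (t : d.-tuple R) : T * T := (x, tuple_mod1 t).

Lemma measurable_pair_mod1 x : measurable_fun [set: d.-tuple R] (pair_mod1 x).
Proof.
apply/measurable_fun_pairP; split; first exact: measurable_cst.
exact: measurable_tuple_mod1.
Qed.

HB.instance Definition _ x := isMeasurableFun.Build _ _ _ _
  (pair_mod1 x) (measurable_pair_mod1 x).

Local Notation lam := (@cube_lebesgue R d).

Section piece.
Variables (x : T) (A : set (d.-tuple R)).
Hypothesis mA : measurable A.

(** Haar measure restricted to the target A, coupled with the single point x. *)
Definition piece : set (T * T) -> \bar R :=
  pushforward (mrestr lam mA) (pair_mod1 x).

Let piece0 : piece set0 = 0%E. Proof. exact: measure0. Qed.

Let piece_ge0 E : (0 <= piece E)%E. Proof. exact: measure_ge0. Qed.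

Let piece_sigma_additive : semi_sigma_additive piece.
Proof. exact: measure_semi_sigma_additive. Qed.

HB.instance Definition _ := isMeasure.Build _ _ _ piece
  piece0 piece_ge0 piece_sigma_additive.

Local Open Scope ereal_scope.

(** Stated for simple functions because [plan_cost] bounds the integral of the
squared distance as a supremum over the simple functions below it. *)
Lemma integral_piece_le (h : {nnsfun (T * T)%type >-> R}) (D : R) :
  (forall t, A t -> (h (pair_mod1 x t) <= D)%R) -> (0 <= D)%R ->
  \int[piece]_p (h p)%:E <= D%:E * lam A.
Proof.
move=> hD D0; rewrite /piece ge0_integral_pushforward//=; last 2 first.
- exact/measurable_EFinP.
- by move=> y _; rewrite lee_fin.
rewrite preimage_setT.
apply: (@le_trans _ _ (\int[mrestr lam mA]_(x in setT) (cst D%:E) x)).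
  apply: ae_ge0_le_integral => //=.
  - by move=> t _; rewrite lee_fin.
  - by apply/measurable_EFinP; apply: measurableT_comp => //;
      exact: measurable_pair_mod1.
  - exists (~` A); split; first exact: measurableC.
      by rewrite /mrestr setICl measure0.
    move=> t /= ht At; apply: ht => _; rewrite lee_fin; exact: hD.
by rewrite integral_cst// -[in leRHS](setTI A).
Qed.

End piece.

Variables (P : finType) (p0 : P) (c : P -> {nonneg R}) (x : P -> T).
Variables (A : P -> set (d.-tuple R)) (mA : forall p, measurable (A p)).

Local Open Scope ereal_scope.

(** The mass carried by the point x p is spread uniformly over the target A p with
weight c p. Targets are sets of points of the cube. *)
Definition plan : {measure set (T * T) -> \bar R} :=
  msum (fun k => let p := nth p0 (enum P) k in
    mscale (c p) (piece (x p) (mA p))) #|P|.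

Lemma sum_nth_enum (F : P -> \bar R) :
  \sum_(k < #|P|) F (nth p0 (enum P) k) = \sum_p F p.
Proof.
by rewrite -[RHS]big_enum (big_nth p0) big_mkord -cardE.
Qed.

Lemma planE E : plan E =
  \sum_p (c p)%:num%:E * lam ((pair_mod1 (x p) @^-1` E) `&` A p).
Proof. by rewrite -sum_nth_enum. Qed.

Variables (mu : {measure set T -> \bar R}) (D : R).
Hypothesis D_ge0 : (0 <= D)%R.
Hypothesis plan_fst : forall E, measurable E ->
  \sum_p (c p)%:num%:E * (lam (A p) * (\1_E (x p))%:E) = mu E.
Hypothesis plan_snd : forall t, (\sum_p (c p)%:num * \1_(A p) t = 1)%R.
Hypothesis plan_dist : forall p t, A p t ->
  (torus_dist (x p) (tuple_mod1 t) <= D)%R.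

Lemma plan_snd_marginal E : measurable E ->
  plan (snd @^-1` E) = torus_haar R d E.
Proof.
move=> mE; rewrite planE.
have mB : measurable (@tuple_mod1 R d @^-1` E).
  by rewrite -[X in measurable X]setTI; exact: measurable_tuple_mod1.
transitivity (\sum_p \int[lam]_(t in @tuple_mod1 R d @^-1` E)
    ((c p)%:num * \1_(A p) t)%:E).
  apply: eq_bigr => p _; under eq_integral do rewrite EFinM.
  have m1 : measurable_fun (@tuple_mod1 R d @^-1` E)
      (fun t => (\1_(A p) t : R)%:E).
    apply/measurable_EFinP; apply: measurable_funTS.
    exact: measurable_indic.
  by rewrite (ge0_integralZl lam mB m1)// integral_indic// setIC.
rewrite -(ge0_integral_sum lam mB); last 2 first.
- move=> p; apply/measurable_EFinP; apply: measurable_funM.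
    exact: measurable_cst.
  by apply: measurable_funTS; exact: measurable_indic.
- by move=> p t _; rewrite lee_fin mulr_ge0.
under eq_integral do rewrite sumEFin plan_snd.
by rewrite integral_cst// mul1e.
Qed.

Lemma plan_coupling : couplings mu (torus_haar R d) plan.
Proof.
move=> E mE; split; last exact: plan_snd_marginal.
rewrite /pushforward planE -plan_fst//; apply: eq_bigr => p _; congr (_ * _).
rewrite indicE; have [xE|xE] := boolP (x p \in E).
  rewrite mule1 (_ : _ `&` _ = A p)//; apply/seteqP; split=> t /= => [[]//|At].
  by split=> //; rewrite inE in xE.
rewrite mule0 (_ : _ `&` _ = set0) ?measure0//.
apply/seteqP; split=> t //= -[xE' _].
by rewrite notin_setE in xE.
Qed.

Lemma plan_cost : \int[plan]_p (torus_dist p.1 p.2 ^+ 2)%:E <= (D ^+ 2)%:E.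
Proof.
rewrite ge0_integralTE; last by move=> p; rewrite lee_fin sqr_ge0.
apply: ge_ereal_sup => _ /= [h hf <-].
have -> : sintegral plan h = \int[plan]_p (h p)%:E.
  by rewrite integral_nnsfun// patch_setT.
rewrite integral_measure_sum_nnsfun//.
have le1 : forall p, \int[mscale (c p) (piece (x p) (mA p))]_q (h q)%:E <=
    (c p)%:num%:E * ((D ^+ 2)%:E * lam (A p)).
  move=> p; rewrite ge0_integral_mscale//; last 2 first.
  - exact/measurable_EFinP.
  - by move=> q _; rewrite lee_fin.
  apply: lee_wpmul2l; first by rewrite lee_fin.
  apply: integral_piece_le; last exact: sqr_ge0.
  move=> t At; have := hf (pair_mod1 (x p) t).
  rewrite lee_fin => /le_trans; apply.
  have t0 := torus_dist_ge0 (x p) (tuple_mod1 t).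
  by rewrite ler_sqr ?nnegrE//=; exact: plan_dist.
apply: (@le_trans _ _ (\sum_p (c p)%:num%:E * ((D ^+ 2)%:E * lam (A p)))).
  by rewrite -sum_nth_enum; apply: lee_sum => k _; exact: le1.
have : plan (snd @^-1` setT) = 1.
  by rewrite plan_snd_marginal// probability_setT.
rewrite planE => e1.
under eq_bigr do rewrite muleCA.
rewrite -ge0_sume_distrr; last by move=> p _; rewrite mule_ge0.
rewrite (_ : \sum_p _ = 1) ?mule1// -e1; apply: eq_bigr => p _.
by congr (_ * lam _); rewrite preimage_setT setTI.
Qed.

(** The cost is bounded pointwise, so this is in fact a bound for the
infinity-Wasserstein distance. *)
Lemma W2_le : W2 mu (torus_haar R d) <= D%:E.
Proof.
have -> : D%:E = sqrte (D ^+ 2)%:E by rewrite /= sqrtr_sqr ger0_norm.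
rewrite /W2 lee_sqrt ?lee_fin ?sqr_ge0//.
apply: (le_trans _ plan_cost); apply: ereal_inf_lbound.
by exists plan => //; exact: plan_coupling.
Qed.

End coupling.

(** * Haar measure of the cubes *)

Section cube_measure.
Context {R : realType}.
Local Notation U := (uniform_prob (@ltr01 R)).

Lemma uniform01_probE (A : set R) : measurable A ->
  U A = lebesgue_measure (A `&` `[0, 1]).
Proof.
move=> mA; rewrite /uniform_prob integral_uniform_pdf.
rewrite (eq_integral (cst 1%E)); last first.
  move=> x; rewrite inE/= in_itv/= => -[_ x01].
  by rewrite /uniform_pdf x01 subr0 invr1.
by rewrite integral_cst ?mul1e//; exact: measurableI.
Qed.

Lemma measurable_flr : measurable_fun [set: R] (@flr R).
Proof. by apply: nondecreasing_measurable => // x y; exact: ler_flr. Qed.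

Lemma measurable_arc (s y : R) : measurable [set x | arc_ind s (x - y) = 1].
Proof.
rewrite -[X in measurable X]setTI.
have m : measurable_fun [set: R] (fun x => arc_ind s (x - y)).
  apply: measurable_funB;
    (apply: measurableT_comp; first exact: measurable_flr);
  by repeat (apply: measurable_funB || exact: measurable_cst
             || exact: measurable_id).
exact: (m measurableT [set 1]).
Qed.

(** Modulo 1 the corner is r/n with r < n, so that [r/n, r/n + 1/n) does not wrap
around. Inside the closed unit interval the arc can only differ from it at the
end point 1, which is negligible. *)
Lemma uniform_arc (n : nat) (y : R) : (0 < n)%N -> n%:R * y \is a Num.int ->
  U [set x | arc_ind n%:R^-1 (x - y) = 1] = (n%:R^-1)%:E.
Proof.
move=> n0 /intrP[a ay]; set s := n%:R^-1.
have nR : 0 < n%:R :> R by rewrite ltr0n.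
have s0 : 0 < s by rewrite invr_gt0.
have s01 := @inv01 R _ n0; rewrite -/s in s01.
have n0z : (0 : int) < n%:Z by rewrite ltz_nat.
pose r := `|(a %% n%:Z)%Z|%N.
have rE : (r%:Z = a %% n%:Z)%Z by rewrite /r gez0_abs// modz_ge0// gt_eqF.
have rn : (r < n)%N by rewrite -ltz_nat rE ltz_pmod.
have yE : y = s * r%:R + ((a %/ n%:Z)%Z)%:~R.
  have : n%:R * y = ((a %/ n%:Z)%Z * n%:Z + (a %% n%:Z)%Z)%:~R.
    by rewrite ay -divz_eq.
  rewrite -rE intrD intrM -!pmulrn => e.
  by apply: (mulfI (lt0r_neq0 nR)); rewrite e /s; field; rewrite gt_eqF.
have nz : n%:R != 0 :> R by rewrite gt_eqF.
have sn : s * n%:R = 1 by rewrite mulVf.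
have rs : s * r%:R + s <= 1.
  have : s * r.+1%:R <= s * n%:R by rewrite ler_pM2l// ler_nat.
  by rewrite sn -natr1; lra.
have rs0 : 0 <= s * r%:R by rewrite mulr_ge0// ltW.
rewrite uniform01_probE; last exact: measurable_arc.
have in_arcE x : 0 <= x < 1 ->
    (arc_ind s (x - y) = 1 <-> s * r%:R <= x < s * r%:R + s).
  move=> x01; rewrite yE opprD addrA (@arc_indD _ s (x - _)) ?rpredN//;
    last exact: intr_int.
  rewrite arc_indE//.
  case: (leP (s * r%:R) x) => /= h; last first.
    rewrite (@flr_uniq _ (x - s * r%:R) (-1)) ?rpredN ?rpred1//; [|lra..].
    case: ltP => /= h'; split=> //; first by lra.
    by move/eqP; rewrite eq_sym oner_eq0.
  rewrite (@flr_uniq _ (x - s * r%:R) 0) ?rpred0//; [|lra..].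
  rewrite subr0 ltrBlDl; case: ltP => // _; split=> //.
  by move/eqP; rewrite eq_sym oner_eq0.
pose I := `[s * r%:R, s * r%:R + s[%classic : set R.
have mI : lebesgue_measure I = s%:E.
  rewrite lebesgue_measure_itv/= lte_fin ltrDl s0 -EFinB.
  by rewrite addrAC subrr add0r.
apply/eqP; rewrite eq_le; apply/andP; split.
- rewrite -mI -[leRHS]adde0 -(lebesgue_measure_set1 (1 : R)).
  apply: le_trans (measureU2 _ _ _) => //=; last exact: measurable_itv.
  apply: le_measure; rewrite ?inE.
  + by apply: measurableI => //; exact: measurable_arc.
  + by apply: measurableU => //; exact: measurable_itv.
  + move=> x [hx]; rewrite /= in_itv/= => /andP[x0 x1].
    move: x1; rewrite le_eqVlt => /orP[/eqP ->|x1]; first by right.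
    by left; rewrite /I/= in_itv/=; apply/in_arcE => //; rewrite x0.
- rewrite -mI; apply: le_measure; rewrite ?inE.
  + exact: measurable_itv.
  + by apply: measurableI => //; exact: measurable_arc.
  + move=> x; rewrite /I/= !in_itv/= => /andP[h1 h2].
    by split; [apply/in_arcE|]; lra.
Qed.

Lemma measurable_box d (B : 'I_d -> set R) : (forall j, measurable (B j)) ->
  measurable [set t : d.-tuple R | forall j, B j (tnth t j)].
Proof.
move=> mB; rewrite (_ : mkset _ = \bigcap_(j in [set: 'I_d])
    ((@tnth d R)^~ j @^-1` B j)); last first.
  by apply/seteqP; split=> t /= h j; [move=> _; exact: h|exact: h].
apply: fin_bigcap_measurable => // j _.
by rewrite -[X in measurable X]setTI; exact: measurable_tnth.
Qed.

Lemma box_measure d (B : 'I_d -> set R) (b : 'I_d -> R) :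
  (forall j, measurable (B j)) -> (forall j, U (B j) = (b j)%:E) ->
  cube_lebesgue d [set t : d.-tuple R | forall j, B j (tnth t j)] =
  (\prod_j b j)%:E.
Proof.
elim: d B b => [|d IH] B b mB UB.
  rewrite big_ord0 /= /dirac/= indicE mem_set//=.
  by case.
rewrite big_ord_recl EFinM -UB -(IH (fun j => B (lift ord0 j))) //=.
rewrite /distribution /pushforward -product_measure1E; last 2 first.
- exact: mB.
- by apply: (@measurable_box _ (fun j => B (lift ord0 j))) => j; exact: mB.
congr (_ _); apply/seteqP; split=> -[x t] /= h.
  split; first exact: (h ord0).
  by move=> j; have := h (lift ord0 j); rewrite tnthS.
move=> j; case: (unliftP ord0 j) => [i ->|->]; last by have := h.1.
by rewrite tnthS; exact: h.2.
Qed.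

Definition row_of d (t : d.-tuple R) : 'rV[R]_d := \row_j tnth t j.

Lemma cube_setE d (s : R) (y : 'rV[R]_d) : 0 <= s <= 1 ->
  [set t | cube_ind s (row_of t) y = 1] =
  [set t : d.-tuple R |
    forall j, [set x | arc_ind s (x - y ord0 j) = 1] (tnth t j)].
Proof.
move=> s01; apply/seteqP; split=> t /= h; last first.
  by apply: big1 => j _; rewrite mxE.
have /prodf_neq0 h' : cube_ind s (row_of t) y != 0 by rewrite h oner_neq0.
by move=> j; have := (arc_ind_neq0 s01 (h' j isT)).1; rewrite mxE.
Qed.

Lemma measurable_cube d (s : R) (y : 'rV[R]_d) : 0 <= s <= 1 ->
  measurable [set t : d.-tuple R | cube_ind s (row_of t) y = 1].
Proof.
move=> s01; rewrite cube_setE//.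
apply: (@measurable_box _ (fun j => [set x | arc_ind s (x - y ord0 j) = 1])).
by move=> j; exact: measurable_arc.
Qed.

Lemma cube_measure d (n : nat) (y : 'rV[R]_d) : (0 < n)%N ->
  (forall j, n%:R * y ord0 j \is a Num.int) ->
  cube_lebesgue d [set t : d.-tuple R | cube_ind n%:R^-1 (row_of t) y = 1] =
  (n%:R^-1 ^+ d)%:E.
Proof.
move=> n0 yZ; rewrite cube_setE ?inv01//.
rewrite (@box_measure _ (fun j => [set x | arc_ind n%:R^-1 (x - y ord0 j) = 1])
  (fun=> n%:R^-1)).
- by rewrite prodr_const card_ord.
- by move=> j; exact: measurable_arc.
- by move=> j; exact: uniform_arc.
Qed.

End cube_measure.

(** * One-step transport along a flux *)

Section grid.
Context {R : realType} {d : nat}.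
Variable n : nat.
Hypothesis n_gt0 : (0 < n)%N.
Local Notation s := (n%:R^-1 : R).

Let nR : 0 < n%:R :> R. Proof. by rewrite ltr0n. Qed.
Let nz : n%:R != 0 :> R. Proof. by rewrite gt_eqF. Qed.
Let s01 : 0 <= s <= 1. Proof. exact: inv01. Qed.

(** The corner of the cell of the grid of side 1/n that contains x. *)
Definition grid (x : 'rV[R]_d) : 'rV[R]_d :=
  \row_j (s * flr (n%:R * x ord0 j)).

Definition on_grid (y : 'rV[R]_d) := forall j, n%:R * y ord0 j \is a Num.int.

Lemma grid_on_grid x : on_grid (grid x).
Proof. by move=> j; rewrite mxE mulrA divff// mul1r flr_int. Qed.

Lemma on_gridD y z : on_grid y -> on_grid z -> on_grid (y + z).
Proof. by move=> yZ zZ j; rewrite mxE mulrDr rpredD. Qed.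

Lemma on_gridN y : on_grid y -> on_grid (- y).
Proof. by move=> yZ j; rewrite mxE mulrN rpredN. Qed.

Lemma arc_ind_gridE (x y : R) : n%:R * y \is a Num.int ->
  arc_ind s (x - y) =
  `[< exists2 z, z \is a Num.int & flr (n%:R * x) = n%:R * (y + z) >]%:R.
Proof.
move=> yZ; rewrite arc_indE//.
have h1 := flr_le (x - y); have h2 := lt_flr1 (x - y).
suff -> : (x - y - flr (x - y) < s) =
    `[< exists2 z, z \is a Num.int & flr (n%:R * x) = n%:R * (y + z) >] by [].
apply/idP/asboolP => [lt|[z zZ e]].
  exists (flr (x - y)); first exact: flr_int.
  apply: flr_uniq.
  - by rewrite mulrDr rpredD// rpredM ?natr_int ?flr_int.
  - by rewrite ler_pM2l//; lra.
  - rewrite -ltrBDl -mulrBr mulrC -ltr_pdivlMr// mul1r; lra.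
have := flr_le (n%:R * x); have := lt_flr1 (n%:R * x); rewrite {}e => h3 h4.
have h5 : x < y + z + s.
  by rewrite -(ltr_pM2l nR) mulrDr divff.
have h6 : y + z <= x by rewrite -(ler_pM2l nR).
have /andP[s0 s1] := s01.
by rewrite (flr_uniq zZ); lra.
Qed.

(** The point t lies in the cell of x translated by tau if and only if x lies in
the cell of t translated by - tau. *)
Lemma cube_ind_swap (t x tau : 'rV[R]_d) : on_grid tau ->
  cube_ind s t (grid x + tau) = cube_ind s x (grid t - tau).
Proof.
move=> tauZ; apply: eq_bigr => j _.
have h1 := on_gridD (grid_on_grid x) tauZ j.
have h2 := on_gridD (grid_on_grid t) (on_gridN tauZ) j.
rewrite !arc_ind_gridE//; congr (nat_of_bool _)%:R; apply: asbool_equiv_eq.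
rewrite !mxE.
move: (flr (n%:R * t ord0 j)) (flr (n%:R * x ord0 j)) (tau ord0 j) => a b c.
split=> -[z zZ]; rewrite !mulrDr !mulrA divff// !mul1r => e; exists (- z);
  rewrite ?rpredN// !mulrDr mulrA divff// mul1r; lra.
Qed.

Lemma cube_ind_grid (x y : 'rV[R]_d) : on_grid y -> cube_ind s x y != 0 ->
  exists2 z, z \in @int_lattice R d & grid x = y + z.
Proof.
move=> yZ /prodf_neq0 h.
have /choice[z hz] : forall j, exists z : R, z \is a Num.int /\
    flr (n%:R * x ord0 j) = n%:R * (y ord0 j + z).
  move=> j; have := h j isT; rewrite arc_ind_gridE//.
  by case: asboolP => [[z zZ e] _|]; [exists z|rewrite eqxx].
exists (\row_j z j); first by apply/latticeP => j; rewrite mxE; case: (hz j).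
by apply/rowP => j; rewrite !mxE (hz j).2 mulrA mulVf// mul1r.
Qed.

Lemma grid_itv (x : R) : s * flr (n%:R * x) <= x < s * flr (n%:R * x) + s.
Proof.
have s0 : 0 < s by rewrite invr_gt0.
apply/andP; split; first by rewrite -[leRHS](mulKf nz) ler_pM2l// flr_le.
rewrite -[ltLHS](mulKf nz) -[X in _ + X]mulr1 -mulrDr ltr_pM2l//.
exact: lt_flr1.
Qed.

Lemma axis_on_grid k : on_grid (s *: axis k).
Proof. by move=> j; rewrite !mxE mulrA divff// mul1r natr_int. Qed.

End grid.

Section transport.
Context {R : realType} {d : nat}.
Variables (n N : nat) (p : nat -> 'rV[R]_d) (K : R).
Variable F : 'I_d -> 'rV[R]_d -> R.
Hypotheses (n_gt0 : (0 < n)%N) (N_gt0 : (0 < N)%N).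
Local Notation s := (n%:R^-1 : R).
Let f y : R := \sum_(i < N) cube_ind s (p i) y.
Hypothesis F_periodic : forall k, lattice_periodic (F k).
Hypothesis F_le : forall k y, `|F k y| <= K.
Hypothesis F_div : forall y,
  f y - N%:R * s ^+ d = \sum_(k < d) (F k y - F k (y + s *: axis k)).
Hypothesis f_gt0 : forall y, 0 < f y.
Hypothesis f_ge : forall y, 2 * d%:R * K <= f y.

(** A cell can send mass across each of its 2d faces, or keep it. *)
Let move_idx : finType := ('I_d + 'I_d + unit)%type.

Let shift (tau : move_idx) : 'rV[R]_d :=
  match tau with
  | inl (inl k) => - (s *: axis k)
  | inl (inr k) => s *: axis k
  | inr _ => 0
  end.

(** The mass that the cell at y sends in direction tau. Across each face both
cells send K / 2 plus or minus half of the flux, so that the net exchange is the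
flux, no amount is negative, and everything is affine in F. What remains in the
cell is nonnegative because f >= 2 d K. *)
Let W (tau : move_idx) y : R :=
  match tau with
  | inl (inl k) => (K + F k y) / 2
  | inl (inr k) => (K - F k (y + s *: axis k)) / 2
  | inr _ => (f y + N%:R * s ^+ d) / 2 - d%:R * K
  end.

Let nz : n%:R != 0 :> R. Proof. by rewrite pnatr_eq0 -lt0n. Qed.
Let Nz : N%:R != 0 :> R. Proof. by rewrite pnatr_eq0 -lt0n. Qed.
Let s01 : 0 <= s <= 1. Proof. exact: inv01. Qed.

Lemma sum_move_idx (G : move_idx -> R) : \sum_tau G tau =
  \sum_k (G (inl (inl k)) + G (inl (inr k))) + G (inr tt).
Proof.
rewrite !big_sumType/= big_split; congr (_ + _).
by rewrite (big_pred1 tt) => // -[].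
Qed.

Lemma W_ge0 tau y : 0 <= W tau y.
Proof.
case: tau => [[k|k]|_] /=.
- by have := F_le k y; rewrite ler_norml; lra.
- by have := F_le k (y + s *: axis k); rewrite ler_norml; lra.
- have := f_ge y; have : 0 <= N%:R * s ^+ d by rewrite mulr_ge0// exprn_ge0.
  lra.
Qed.

Lemma W_periodic tau : lattice_periodic (W tau).
Proof.
move=> y z zZ; case: tau => [[k|k]|_] /=.
- by rewrite (F_periodic _ _ zZ).
- by rewrite addrAC (F_periodic _ _ zZ).
- congr ((_ + _) / _ - _); apply: eq_bigr => i _; exact: cube_ind_periodic.
Qed.

Let sumK : \sum_(k < d) K = d%:R * K.
Proof. by rewrite sumr_const card_ord mulr_natl. Qed.

Lemma sum_W_out y : \sum_tau W tau y = f y.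
Proof.
rewrite sum_move_idx /=.
have -> : \sum_k ((K + F k y) / 2 + (K - F k (y + s *: axis k)) / 2) =
  d%:R * K + (f y - N%:R * s ^+ d) / 2.
  rewrite F_div mulr_suml -sumK.
  by rewrite -big_split; apply: eq_bigr => k _ /=; lra.
lra.
Qed.

(** Every cell receives its fair share: this is the divergence equation. *)
Lemma sum_W_in y : \sum_tau W tau (y - shift tau) = N%:R * s ^+ d.
Proof.
rewrite sum_move_idx /= subr0.
have -> : \sum_k ((K + F k (y - - (s *: axis k))) / 2 +
                  (K - F k (y - s *: axis k + s *: axis k)) / 2) =
  d%:R * K - (f y - N%:R * s ^+ d) / 2.
  rewrite F_div mulr_suml -sumK.
  by rewrite -sumrB; apply: eq_bigr => k _ /=; rewrite opprK subrK; lra.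
lra.
Qed.

Let shift_on_grid tau : on_grid n (shift tau).
Proof.
case: tau => [[k|k]|_] /=.
- by apply: on_gridN; exact: axis_on_grid.
- exact: axis_on_grid.
- by move=> j; rewrite mxE mulr0 rpred0.
Qed.

Let pair_idx : finType := ('I_N * move_idx)%type.

(** The points of a cell share equally what the cell sends. The factor n^d turns
masses into densities with respect to Haar measure on the target cell. *)
Let weight (q : pair_idx) : R :=
  W q.2 (grid n (p q.1)) / (f (grid n (p q.1)) * N%:R) * n%:R ^+ d.

Let weight_ge0 q : 0 <= weight q.
Proof.
rewrite mulr_ge0 ?exprn_ge0// divr_ge0 ?W_ge0// mulr_ge0//.
by rewrite ltW// f_gt0.
Qed.

Let target (q : pair_idx) : set (d.-tuple R) :=
  [set t | cube_ind s (row_of t) (grid n (p q.1) + shift q.2) = 1].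

Let measurable_target q : measurable (target q).
Proof. exact: measurable_cube. Qed.

Lemma target_mass q : cube_lebesgue d (target q) = (s ^+ d)%:E.
Proof.
apply: cube_measure => //; apply: on_gridD; last exact: shift_on_grid.
exact: grid_on_grid.
Qed.

Lemma sum_weight i : \sum_tau weight (i, tau) * s ^+ d = N%:R^-1.
Proof.
have fz := lt0r_neq0 (f_gt0 (grid n (p i))).
have nd : n%:R ^+ d * s ^+ d = 1 by rewrite -exprMn divff// expr1n.
under eq_bigr do rewrite /weight -mulrA nd mulr1 /=.
by rewrite -mulr_suml sum_W_out invfM mulrA divff// mul1r.
Qed.

(** The density received at t only depends on the cell of t: by [cube_ind_swap]
the points that send mass to t in direction tau are those of the cell of t
translated by - tau, and their weights add up to what this cell sends. *)
Lemma weight_density t : \sum_q weight q * \1_(target q) t = 1.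
Proof.
have nd : s ^+ d * n%:R ^+ d = 1 by rewrite -exprMn mulVf// expr1n.
transitivity (\sum_tau W tau (grid n (row_of t) - shift tau) *
    (n%:R ^+ d / N%:R)).
  rewrite -(pair_bigA _
    (fun i tau => weight (i, tau) * \1_(target (i, tau)) t)).
  rewrite exchange_big; apply: eq_bigr => tau _ /=.
  pose y := grid n (row_of t) - shift tau.
  have yg : on_grid n y.
    by apply: on_gridD; [exact: grid_on_grid|apply: on_gridN].
  rewrite -/y; transitivity (\sum_(i < N)
      W tau y / f y * (n%:R ^+ d / N%:R) * cube_ind s (p i) y).
    apply: eq_bigr => i _.
    have -> : \1_(target (i, tau)) t = cube_ind s (p i) y :> R.
      rewrite indicE /y -cube_ind_swap//.
      set c := cube_ind _ _ _; have [c0|c0] := eqVneq c 0.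
        rewrite memNset ?c0// /target/= -/c c0 => /eqP.
        by rewrite eq_sym oner_eq0.
      have [c1 _] := cube_ind_neq0 s01 c0.
      by rewrite mem_set ?c1.
    have [->|c0] := eqVneq (cube_ind s (p i) y) 0; first by rewrite !mulr0.
    have [z zZ e] := cube_ind_grid n_gt0 yg c0.
    have fe : f (grid n (p i)) = f y.
      by rewrite e; apply: eq_bigr => k _; rewrite cube_ind_periodic.
    rewrite /weight /= fe e W_periodic//; congr (_ * _).
    by rewrite invfM; ring.
  by rewrite -mulr_sumr -/(f y) mulrAC mulfVK// gt_eqF// f_gt0.
by rewrite -mulr_suml sum_W_in [_ / N%:R]mulrC mulrACA nd mulr1 divff.
Qed.

(** Source and target lie in equal or adjacent cells. *)
Lemma target_dist q t : target q t ->
  torus_dist (mod1 (p q.1)) (tuple_mod1 t) <= Num.sqrt d%:R * (2 * s).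
Proof.
rewrite /target/= => h.
have c0 : cube_ind s (row_of t) (grid n (p q.1) + shift q.2) != 0.
  by rewrite h oner_neq0.
have [_ [z zZ hz]] := cube_ind_neq0 s01 c0.
apply: le_trans (torus_dist_le _ _ (_ : - z \in _)) _; first by rewrite rpredN.
have /andP[s0 s1] := s01.
have -> : Num.sqrt d%:R * (2 * s) = Num.sqrt (\sum_(j < d) (2 * s) ^+ 2).
  rewrite sumr_const card_ord -[(_ ^+ 2) *+ d]mulr_natl sqrtrM//.
  by rewrite sqrtr_sqr ger0_norm.
apply: ler_wsqrtr; apply: ler_sum => j _.
have hs : `|shift q.2 ord0 j| <= s.
  case: (q.2) => [[k|k]|_] /=;
    rewrite !mxE ?normrN ?normr0// normrM (ger0_norm s0).
    by rewrite ler_piMr// normr_nat lern1 leq_b1.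
  by rewrite ler_piMr// normr_nat lern1 leq_b1.
have := hz j; rewrite !mxE; move: hs; rewrite ler_norml => hs hzj.
have hp := grid_itv n_gt0 (p q.1 ord0 j).
rewrite -[leLHS]real_normK ?num_real// ler_sqr ?nnegrE ?mulr_ge0// ler_norml.
by lra.
Qed.

(** If every cell holds enough mass compared with the flux, each cell passes its
share on to its neighbours in one step, and no mass travels further than two
sides of a cell in each coordinate. *)
Lemma transport (x : nat -> torus R d) : (forall k, x k.+1 = mod1 (p k)) ->
  (W2 (empirical_measure x N) (torus_haar R d) <=
    (Num.sqrt d%:R * (2 * s))%:E)%E.
Proof.
move=> xp.
have D0 : 0 <= Num.sqrt d%:R * (2 * s) :> R.
  by rewrite mulr_ge0 ?sqrtr_ge0// mulr_ge0//; case/andP: s01.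
pose q0 : pair_idx := (Ordinal N_gt0, inr tt).
apply: (@W2_le R d pair_idx q0 (fun q => NngNum (weight_ge0 q))
  (fun q => mod1 (p q.1)) target measurable_target _ _ D0).
- move=> E mE /=.
  transitivity (\sum_(i < N) N%:R^-1 * (\1_E (mod1 (p i)) : R))%:E.
    rewrite -(pair_bigA _ (fun i tau => ((weight (i, tau))%:E *
      (cube_lebesgue d (target (i, tau)) * (\1_E (mod1 (p i)))%:E))%E)).
    rewrite -sumEFin; apply: eq_bigr => i _.
    under eq_bigr do rewrite target_mass -!EFinM.
    rewrite sumEFin; congr EFin; under eq_bigr do rewrite mulrA.
    by rewrite -mulr_suml sum_weight.
  rewrite -mulr_sumr EFinM -sumEFin /empirical_measure /mscale /= /msum.
  by congr (_ * _)%E; apply: eq_bigr => i _; rewrite xp.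
- exact: weight_density.
- by move=> q t; exact: target_dist.
Qed.

End transport.

(** * The Kronecker sequence *)

Section kronecker_sequence.
Context {R : realType} {d : nat}.

Lemma powR_root_le (N : nat) (X : R) : (0 < d)%N -> 0 <= X -> N%:R <= X ^+ d ->
  N%:R `^ d%:R^-1 <= X.
Proof.
move=> d0 X0 NX.
have dz : d%:R != 0 :> R by rewrite pnatr_eq0 -lt0n.
have -> : X = (X ^+ d) `^ d%:R^-1.
  by rewrite -powR_mulrn// -powRrM divff// powRr1.
by apply: ge0_ler_powR; rewrite ?invr_ge0 ?nnegrE ?exprn_ge0.
Qed.

Lemma badly_approximable_separated (M : nat) (c : R) (alpha : 'rV[R]_d) :
  (0 < d)%N -> 0 < c -> 1 <= M%:R * c -> badly_approximable alpha c ->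
  separated_multiples M alpha.
Proof.
move=> d0 c0 Mc ba q X rho q0 X0 qX [z /latticeP zZ hz].
have rho0 : 0 <= rho by rewrite (le_trans _ (hz (Ordinal d0))).
have le : c / q%:R `^ d%:R^-1 <= rho.
  apply: (le_trans (ba q q0)); apply: bigmax_le => // j _.
  apply: le_trans (hz j); have /intrP[m zm] := zZ j.
  apply: ge_inf; first by exists 0 => _ [m' _ <-].
  by exists m => //; rewrite mxE zm mulrC.
have p0 : 0 < q%:R `^ d%:R^-1 :> R by rewrite powR_gt0// ltr0n.
rewrite ler_pdivrMr// in le.
have := powR_root_le d0 (ltW X0) qX => le2.
apply: (le_trans Mc); rewrite -mulrA ler_wpM2l// (le_trans le)//.
by rewrite ler_wpM2l.
Qed.

Lemma inv_powR_le (N Q : nat) : (0 < d)%N -> (0 < N)%N -> (N <= Q ^ d)%N ->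
  Q%:R^-1 <= N%:R `^ (- d%:R^-1) :> R.
Proof.
move=> d0 N0 NQ; rewrite powRN.
have Q0 : (0 < Q)%N by case: Q NQ => //; rewrite exp0n// leqNgt N0.
rewrite lef_pV2 ?posrE ?powR_gt0 ?ltr0n//.
by apply: powR_root_le => //; rewrite -natrX ler_nat.
Qed.

End kronecker_sequence.

Theorem theorem5 (R : realType) (d : nat) (hd : (2 <= d)%N)
    (c : R) (hc : 0 < c) :
  exists2 C : R, 0 < C &
    forall alpha : 'rV[R]_d, badly_approximable alpha c ->
    forall N : nat, (1 <= N)%N ->
      (W2 (empirical_measure (kronecker alpha) N) (torus_haar R d)
        <= (C * N%:R `^ (- d%:R^-1))%:E)%E.
Proof.
have d0 : (0 < d)%N by exact: ltnW.
have mul_pos a b : (0 < a -> 0 < b -> 0 < a * b)%N.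
  by rewrite muln_gt0 => -> ->.
pose M := (Num.trunc c^-1).+1.
have Mc : 1 <= M%:R * c.
  have ci : 0 <= c^-1 by rewrite invr_ge0 ltW.
  have /andP[_ /ltW] := truncn_itv ci.
  by move=> h; rewrite -[X in X <= _](mulVf (lt0r_neq0 hc)) ler_pM2r.
pose A := @hitting_const d M; pose K := @flux_const d M (2 * A).
(* Grouping 2^m0 cubes in each direction gains a factor 2^m0 >= 2 d K of mass
   over flux. *)
pose m0 := (2 * d * K)%N.
have A0 : (0 < A)%N by [].
have sd0 : 0 < Num.sqrt d%:R :> R by rewrite sqrtr_gt0 ltr0n.
pose C := Num.sqrt d%:R * (4 * (A * 2 ^ m0)%:R) : R.
have AR : 0 < (A * 2 ^ m0)%:R :> R.
  by rewrite ltr0n; apply: mul_pos; rewrite ?expn_gt0.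
exists C; first by rewrite /C !mulr_gt0.
move=> alpha ba N N0.
have sep_alpha := badly_approximable_separated d0 hc Mc ba.
pose p (k : nat) : 'rV[R]_d := k.+1%:R *: alpha.
have fE s y :
    \sum_(i < N) cube_ind s (p i) y = cube_count alpha s N (y - alpha).
  by apply: eq_bigr => i _; rewrite -cube_indD /p -natr1 scalerDl scale1r.
(* The last hypothesis says that the side 1/n is not too large compared with
   N^(-1/d). *)
have reduce (n : nat) (L : R) : (0 < n)%N ->
    (bounded_div n%:R^-1 L (discrepancy alpha n%:R^-1 N)) ->
    (forall y, 0 < cube_count alpha n%:R^-1 N y) ->
    (forall y, 2 * d%:R * L <= cube_count alpha n%:R^-1 N y) ->
    (N <= (2 * (A * 2 ^ m0) * n) ^ d)%N ->
    (W2 (empirical_measure (kronecker alpha) N) (torus_haar R d)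
        <= (C * N%:R `^ (- d%:R^-1))%:E)%E.
  move=> n0 /(bounded_div_shift (- alpha))[F [F1 F2 F3]] f1 f2 Nn.
  have le := @transport R d n N p L F n0 N0 F1 F2 _ _ _
    (kronecker alpha) (fun=> erefl).
  apply: (le_trans (le _ _ _)).
  - by move=> y; rewrite fE -F3.
  - by move=> y; rewrite fE.
  - by move=> y; rewrite fE.
  rewrite lee_fin /C -mulrA ler_wpM2l ?sqrtr_ge0//.
  have h := @inv_powR_le R d N _ d0 N0 Nn.
  apply: le_trans (ler_wpM2l _ h); last by rewrite mulr_ge0// ltW.
  have nR : n%:R != 0 :> R by rewrite pnatr_eq0 -lt0n.
  have ARz : (A * 2 ^ m0)%:R != 0 :> R by rewrite gt_eqF.
  rewrite (natrM _ _ n) (natrM _ 2%N) [leRHS](_ : _ = 2 / n%:R)//.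
  by move: ARz; move: (A * 2 ^ m0)%:R => X Xz; field; rewrite nR Xz.
have [small|large] := ltnP N ((A * 2 ^ m0) ^ d).
  (* A single cube, the whole torus, is enough for the finitely many small N. *)
  apply: (reduce 1%N 0) => //.
  - apply: bounded_div_eq (bounded_div0 _) => y.
    by rewrite /discrepancy invr1 cube_count1 expr1n mulr1 subrr.
  - by move=> y; rewrite invr1 cube_count1 ltr0n.
  - by move=> y; rewrite invr1 cube_count1 mulr0.
  - by rewrite (leq_trans (ltnW small))// leq_exp2r// muln1 leq_pmull.
pose P k := ((A * 2 ^ k) ^ d <= N)%N.
have Pb k : P k -> (k <= N)%N.
  move=> Pk; apply: leq_trans Pk.
  apply: leq_trans (ltnW (ltn_expl k (isT : 1 < 2)%N)) _.
  apply: (@leq_trans (A * 2 ^ k)); first by rewrite leq_pmull.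
  have ge1 : (0 < A * 2 ^ k)%N by apply: mul_pos; rewrite ?expn_gt0.
  by rewrite -[leqLHS]expn1 leq_pexp2l.
(* 2^-k is the smallest side at which [all_cubes_hit] applies. *)
have [k Pk kmax] := @ex_maxnP P N (ex_intro _ m0 large) Pb.
have m0k := kmax _ large.
have lt : (N < (A * 2 ^ k.+1) ^ d)%N.
  by rewrite ltnNge; apply/negP => /kmax; rewrite ltnn.
have D : bounded_div (2 ^ k)%:R^-1 K%:R (discrepancy alpha (2 ^ k)%:R^-1 N).
  apply: discrepancy_flux => //; apply: leq_trans (ltnW lt) _.
  by rewrite leq_exp2r// expnS mulnA (mulnC A).
have hits y : 1 <= cube_count alpha (2 ^ k)%:R^-1 N y.
  by apply: (all_cubes_hit (M := M)); rewrite ?expn_gt0.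
pose n := (2 ^ (k - m0))%N.
have sE : n%:R^-1 = 2 ^+ m0 * (2 ^ k)%:R^-1 :> R.
  rewrite /n -{2}(subnK m0k) expnD natrM invfM mulrCA natrX natrX.
  by rewrite divff ?mulr1// expf_eq0 pnatr_eq0 andbF.
apply: (reduce n (2 ^+ (m0 * d.-1) * K%:R)).
- by rewrite expn_gt0.
- by rewrite sE; exact: discrepancy_coarsen_iter.
- move=> y; rewrite sE; apply: lt_le_trans (cube_count_coarsen m0 hits y).
  by rewrite mulr1 exprn_gt0.
- move=> y; rewrite sE; apply: le_trans (cube_count_coarsen m0 hits y).
  have -> : (m0 * d = m0 + m0 * d.-1)%N by rewrite -mulnS prednK.
  rewrite mulr1 exprD mulrCA [leRHS]mulrC ler_wpM2l ?exprn_ge0//.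
  by rewrite -!natrM -natrX ler_nat ltnW// ltn_expl.
- apply: leq_trans (ltnW lt) _.
  rewrite leq_exp2r// /n expnS -{1}(subnK m0k) expnD.
  by apply: eq_leq; ring.
Qed.
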